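(* Let $d>0$ and $\gamma_2\ge\gamma_1\ge0$ be real numbers with $(\gamma_1^2+\gamma_2^2)/2>d^2$, and consider the system $$\left\{\begin{array}{l} a''+\dfrac{a'}{r}-\dfrac{\gamma_1^2}{r^2}a-f_d^2\,b-f_d^2\,a=-(1-f_d^2)\,a\\[2mm] b''+\dfrac{b'}{r}-\dfrac{\gamma_2^2}{r^2}b-f_d^2\,a-f_d^2\,b=-(1-f_d^2)\,b \end{array}\right.\qquad r>0. \quad (S)$$ (1) Let $(a_1,b_1)$ be the solution of $(S)$ defined by $(a_1,b_1)\sim_0\big(O(r^{\gamma_2+2d+2}),\,r^{\gamma_2}\big)$. Then $(a_1,b_1)$ blows up exponentially at $+\infty$. (2) Let $(u_2,v_2)$ be the solution of $(S)$ defined by $(u_2,v_2)\sim_{+\infty}\Big(\dfrac{e^{-\sqrt2 r}}{\sqrt r},\dfrac{e^{-\sqrt2 r}}{\sqrt r}\Big)$. Then $(u_2,v_2)\sim_0 C\big(o(r^{-\gamma_2}),\,r^{-\gamma_2}\big)$ for some constant $C\ne0$.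
   Context: For real $d>0$, $f_d$ denotes the only solution on $(0,+\infty)$ of $f_d''+\frac{f_d'}{r}-\frac{d^2}{r^2}f_d=-f_d(1-f_d^2)$ with $f_d(0)=0$ and $\lim_{r\to+\infty}f_d(r)=1$; it is non-decreasing. All functions are real-valued. Notation at $0$ (and similarly at $+\infty$): $h=O(f)$ means $|h(r)|\le C|f(r)|$ on some interval $(0,R]$ with $R,C>0$; $h=o(f)$ means $h=fg$ for some $g$ with $\lim_0 g=0$; $h\sim_0 f$ means $|h-f|=O(fg)$ for some $g$ with $\lim_0 g=0$. For pairs, the relation is understood componentwise; a component written $O(\cdot)$ or $o(\cdot)$ means that the corresponding component of the solution is $O(\cdot)$, resp. $o(\cdot)$. With $n=\sqrt{(\gamma_1^2+\gamma_2^2)/2-d^2}>0$, the solution space of $(S)$ is four-dimensional with a basis having the behaviors at $+\infty$ $(e^{\sqrt2r}/\sqrt r,e^{\sqrt2r}/\sqrt r)$, $(e^{-\sqrt2r}/\sqrt r,e^{-\sqrt2r}/\sqrt r)$, $(r^{-n},-r^{-n})$, $(r^{n},-r^{n})$. ''Blows up exponentially at $+\infty$'' means: there is a constant $c\neq0$ such that $(a_1,b_1)\sim_{+\infty}c\,(e^{\sqrt2r}/\sqrt r,\,e^{\sqrt2r}/\sqrt r)$.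
   Formalization: In (2), the claim that u_2 is o(r^{-γ_2}) at 0 is made only for γ_1 < γ_2: if γ_1 = γ_2 the system is symmetric, so u_2 = v_2, and the claim is false since v_2 ~ C r^{-γ_2} with C ≠ 0. All other claims cover γ_2 ≥ γ_1. *)

(* Defs.v *)
(* Stdlib reals with Coquelicot. *)
From Stdlib Require Import Reals.
From Coquelicot Require Import Coquelicot.
Open Scope R_scope.

(* Functions on (0,+oo) are represented by total functions R -> R of which only
   the values on (0,+oo) are ever used. *)

(* [Derive] is a total operator, so both orders of differentiability have to be
   required explicitly for u' and u'' to be meaningful. *)
Definition twice_derivable_pos (u : R -> R) : Prop :=
  forall r, 0 < r -> ex_derive u r /\ ex_derive (Derive u) r.

(* The boundary value f(0) = 0 is the limit of f at 0+; the value of the total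
   function at the point 0 is irrelevant. *)
Definition is_vortex_profile (d : R) (f : R -> R) : Prop :=
  twice_derivable_pos f /\
  (forall r, 0 < r ->
     Derive (Derive f) r + Derive f r / r - d ^ 2 / r ^ 2 * f r
       = - (f r * (1 - f r ^ 2))) /\
  filterlim f (at_right 0) (locally 0) /\
  is_lim f p_infty 1.

Definition is_solution_S (gamma1 gamma2 : R) (f a b : R -> R) : Prop :=
  twice_derivable_pos a /\ twice_derivable_pos b /\
  forall r, 0 < r ->
    Derive (Derive a) r + Derive a r / r - gamma1 ^ 2 / r ^ 2 * a r
      - f r ^ 2 * b r - f r ^ 2 * a r = - ((1 - f r ^ 2) * a r) /\
    Derive (Derive b) r + Derive b r / r - gamma2 ^ 2 / r ^ 2 * b r
      - f r ^ 2 * a r - f r ^ 2 * b r = - ((1 - f r ^ 2) * b r).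

(* The asymptotic relations are taken along a filter F, either [at_right 0]
   or [Rbar_locally p_infty]. *)
Definition is_bigO (F : (R -> Prop) -> Prop) (h f : R -> R) : Prop :=
  exists C : R, 0 < C /\ F (fun r => Rabs (h r) <= C * Rabs (f r)).

Definition is_littleo (F : (R -> Prop) -> Prop) (h f : R -> R) : Prop :=
  exists g : R -> R,
    filterlim g F (locally 0) /\ F (fun r => h r = f r * g r).

Definition is_sim (F : (R -> Prop) -> Prop) (h f : R -> R) : Prop :=
  exists g : R -> R,
    filterlim g F (locally 0) /\
    is_bigO F (fun r => Rabs (h r - f r)) (fun r => f r * g r).

Definition exp_growth (r : R) : R := exp (sqrt 2 * r) / sqrt r.

Definition exp_decay (r : R) : R := exp (- sqrt 2 * r) / sqrt r.

Definition blows_up_exponentially (a b : R -> R) : Prop :=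
  exists c : R, c <> 0 /\
    is_sim (Rbar_locally p_infty) a (fun r => c * exp_growth r) /\
    is_sim (Rbar_locally p_infty) b (fun r => c * exp_growth r).

(* Main.v *)
(* With x = a + b, y = b - a, G = (gamma1^2 + gamma2^2) / 2 and
   D = (gamma2^2 - gamma1^2) / 2 >= 0, the system becomes
     x'' + x'/r = (G/r^2 + 3 f^2 - 1) x + (D/r^2) y,
     y'' + y'/r = (G/r^2 + f^2 - 1) y + (D/r^2) x.
   It is cooperative, and since G > d^2 both diagonal operators dominate the one
   annihilating the positive function f.  So positivity of (x, y), together with
   monotonicity of x/f and y/f, propagates away from an end of (0,+oo) at which
   x/f and y/f tend to 0: outwards from 0 in (1), inwards from +oo in (2).  In
   (2) only x and y + eps x are known to be positive near +oo; letting eps tend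
   to 0 still gives x > 0 and y >= 0, that is |u| <= v.  Positivity then forces
   the coefficient of the dominant exponential, respectively of the dominant
   power, to be nonzero.  In the variable ln r, or - ln r, the equations have no
   first-order term. *)

Require Import Defs.
From Stdlib Require Import Reals.
From Coquelicot Require Import Coquelicot.
From Stdlib Require Import Lra Psatz Classical.
Open Scope R_scope.

(** * Wronskians and cooperative systems *)

(** The main obstacle is [f] itself: [is_vortex_profile] gives only the equation and two limits, so
    positivity of the comparison function must be proved, together with two rates. Near 0,
    [f >= c r^d]; as gamma2^2 is at least the mean of the squares, hence above d^2, the power
    r^gamma2 is negligible against [f]. At infinity, 1 - f = O(r^-2), which makes the perturbations
    of the limiting constant-coefficient system integrable. Two pairs of unknowns occur because the
    diagonal changes: at infinity the f^2 coupling is diagonal in (x, y), while at 0 the terms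
    gamma^2/r^2 are diagonal in the original pair. In (2) both components have the same leading term
    at infinity, so the sign of y there is undetermined. Adding eps x restores a sign and costs eps
    D on the diagonal, paid for by the strict gap G - d^2. A dominant coefficient is the limit of
    e^(-k t) (X' + k X), whose derivative is integrable. The same quantity satisfies a Gronwall
    inequality from below, and this is what keeps the limit away from 0. *)

Lemma nondecreasing_of_derive (g g1 : R -> R) (a b : R) :
  a <= b ->
  (forall t, a <= t <= b -> is_derive g t (g1 t)) ->
  (forall t, a < t < b -> 0 <= g1 t) -> g a <= g b.
Proof.
  intros Hab Hd Hp.
  destruct Hab as [Hab | ->]; [|lra].
  destruct (MVT_cor2 g g1 a b Hab) as [c [Hc1 Hc2]].
  { intros c Hc. apply is_derive_Reals, Hd, Hc. }
  specialize (Hp c Hc2). nra.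
Qed.

Lemma increasing_of_derive (g g1 : R -> R) (a b : R) :
  a < b ->
  (forall t, a <= t <= b -> is_derive g t (g1 t)) ->
  (forall t, a < t < b -> 0 < g1 t) -> g a < g b.
Proof.
  intros Hab Hd Hp.
  destruct (MVT_cor2 g g1 a b Hab) as [c [Hc1 Hc2]].
  { intros c Hc. apply is_derive_Reals, Hd, Hc. }
  specialize (Hp c Hc2). nra.
Qed.

Lemma nonincreasing_of_derive (g g1 : R -> R) (a b : R) :
  a <= b ->
  (forall t, a <= t <= b -> is_derive g t (g1 t)) ->
  (forall t, a < t < b -> g1 t <= 0) -> g b <= g a.
Proof.
  intros Hab Hd Hp.
  enough (- g a <= - g b) by lra.
  apply (nondecreasing_of_derive (fun t => - g t) (fun t => - g1 t)); auto.
  - intros t Ht. apply (is_derive_opp g), Hd, Ht.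
  - intros t Ht. specialize (Hp t Ht). lra.
Qed.

(** Continuous induction: the supremum of the initial segments on which [P] holds cannot stop short
    of [t], since the step pushes past it. It plays the role of a first-exit-time argument for
    positivity. *)
Lemma real_induction (P : R -> Prop) (a : R) :
  (forall s, a <= s -> (forall u, a <= u < s -> P u) ->
     exists e, 0 < e /\ forall u, s <= u < s + e -> P u) ->
  forall t, a <= t -> P t.
Proof.
  intros Hstep t Hat.
  set (E := fun s => a <= s <= t /\ forall u, a <= u < s -> P u).
  destruct (completeness E) as [m [Hub Hlub]].
  - exists t. intros s [[_ Hs] _]. exact Hs.
  - exists a. split; [lra|]. intros u Hu. lra.
  - assert (Ham : a <= m). { apply Hub. split; [lra|]. intros u Hu; lra. }
    assert (Hmt : m <= t). { apply Hlub. intros s [[_ Hs] _]. exact Hs. }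
    assert (HP : forall u, a <= u < m -> P u).
    { intros u Hu. apply NNPP. intros Hn.
      enough (m <= u) by lra. apply Hlub. intros s [_ Hs].
      apply Rnot_lt_le. intros Hus. apply Hn, Hs. lra. }
    destruct (Hstep m Ham HP) as [e [He Hme]].
    destruct (Rle_lt_dec t m) as [Htm|Htm].
    { apply Hme. lra. }
    exfalso.
    assert (HE : E (Rmin (m + e / 2) t)).
    { split.
      - split; [apply Rmin_glb; lra | apply Rmin_r].
      - intros u [Hu1 Hu2]. pose proof (Rmin_l (m + e / 2) t).
        destruct (Rlt_le_dec u m); [apply HP; lra | apply Hme; lra]. }
    apply Hub in HE. revert HE.
    unfold Rmin; destruct (Rle_dec _ _); lra.
Qed.

Lemma is_derive_continuity_pt (g : R -> R) (x l : R) :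
  is_derive g x l -> continuity_pt g x.
Proof.
  intros H. apply derivable_continuous_pt. exists l. now apply is_derive_Reals.
Qed.

Lemma continuity_pt_pos (g : R -> R) (x : R) :
  continuity_pt g x -> 0 < g x ->
  exists e, 0 < e /\ forall u, Rabs (u - x) < e -> 0 < g u.
Proof.
  intros Hc Hx. destruct (Hc (g x) Hx) as [e [He H]].
  exists e. split; [exact He|]. intros u Hu.
  destruct (Req_dec x u) as [<-|Hne]; [exact Hx|].
  assert (Rabs (g u - g x) < g x) as Hb.
  { apply (H u). split; [split; [exact I|exact Hne]|exact Hu]. }
  apply Rabs_def2 in Hb. lra.
Qed.

Lemma derive_pos_right (g : R -> R) (x l : R) :
  is_derive g x l -> 0 < l ->
  exists e, 0 < e /\ forall u, x < u < x + e -> g x < g u.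
Proof.
  intros Hd Hl. apply is_derive_Reals in Hd.
  destruct (Hd l Hl) as [[e He] H]. exists e. split; [exact He|].
  intros u Hu. specialize (H (u - x)). simpl in H.
  replace (x + (u - x)) with u in H by ring.
  assert (Hb : Rabs ((g u - g x) / (u - x) - l) < l).
  { apply H; [lra|]. rewrite Rabs_pos_eq; lra. }
  apply Rabs_def2 in Hb. destruct Hb as [_ Hb].
  assert (0 < (g u - g x) / (u - x)) as Hq by lra.
  assert (0 < (g u - g x) / (u - x) * (u - x)) as Hm by (apply Rmult_lt_0_compat; lra).
  replace ((g u - g x) / (u - x) * (u - x)) with (g u - g x) in Hm by (field; lra). lra.
Qed.

Lemma derive_at_max (g g1 g2 : R -> R) (a m b : R) :
  a < m < b ->
  (forall t, a < t < b -> is_derive g t (g1 t)) ->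
  is_derive g1 m (g2 m) ->
  (forall t, a < t < b -> g t <= g m) -> g1 m = 0 /\ g2 m <= 0.
Proof.
  intros Hm Hd Hd2 Hmax.
  assert (H0 : g1 m = 0).
  { destruct (Rtotal_order (g1 m) 0) as [H|[H|H]]; [exfalso| exact H | exfalso].
    (* The reflection t -> -t turns a negative slope into a positive one, so that [derive_pos_right]
       also yields larger values to the left of [m]. *)
    - assert (Hd' : is_derive (fun s => g (- s)) (- m) (- g1 m)).
      { replace (- g1 m) with (scal (-1) (g1 m)) by (unfold scal; simpl; unfold mult; simpl; ring).
        apply (is_derive_comp g Ropp (- m)).
        - rewrite Ropp_involutive. apply Hd; lra.
        - auto_derive; [exact I|ring]. }
      destruct (derive_pos_right _ _ _ Hd') as [e [He Hu]]; [lra|].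
      pose proof (Rmin_l e (m - a)). pose proof (Rmin_r e (m - a)).
      assert (0 < Rmin e (m - a)) by (apply Rmin_pos; lra).
      specialize (Hu (- m + Rmin e (m - a) / 2)).
      specialize (Hmax (- (- m + Rmin e (m - a) / 2))).
      rewrite Ropp_involutive in Hu. lra.
    - destruct (derive_pos_right _ _ _ (Hd m Hm) H) as [e [He Hu]].
      pose proof (Rmin_l e (b - m)). pose proof (Rmin_r e (b - m)).
      assert (0 < Rmin e (b - m)) by (apply Rmin_pos; lra).
      specialize (Hu (m + Rmin e (b - m) / 2)).
      specialize (Hmax (m + Rmin e (b - m) / 2)). lra. }
  split; [exact H0|].
  apply Rnot_lt_le. intros H2.
  destruct (derive_pos_right _ _ _ Hd2 H2) as [e [He Hu]].
  pose proof (Rmin_l e (b - m)). pose proof (Rmin_r e (b - m)).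
  assert (0 < Rmin e (b - m)) by (apply Rmin_pos; lra).
  set (h := Rmin e (b - m) / 2) in *.
  assert (g m < g (m + h)).
  { apply (increasing_of_derive g g1).
    - unfold h; lra.
    - intros t Ht. apply Hd. unfold h in Ht; lra.
    - intros t Ht. rewrite <- H0. apply Hu. unfold h in Ht; lra. }
  specialize (Hmax (m + h)). unfold h in *. lra.
Qed.

(** [auto_derive] leaves terms [Derive (fun s => u s) t] for abstract functions; this replaces such
    a term by the derivative recorded in [H], after which [ring] or [field] can finish. *)
Ltac use_derive H :=
  lazymatch type of H with
  | is_derive ?u ?t ?l =>
      replace (Derive (fun s : R => u s) t) with l
        by (symmetry; apply (is_derive_unique u t l H))
  end.

(** The derivative of x/phi is the Wronskian x' phi - x phi' divided by phi^2. *)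
Lemma wronskian_ratio (phi phi1 x x1 : R -> R) (a b : R) :
  a <= b ->
  (forall t, a <= t <= b -> is_derive phi t (phi1 t)) ->
  (forall t, a <= t <= b -> is_derive x t (x1 t)) ->
  (forall t, a <= t <= b -> 0 < phi t) ->
  (forall t, a < t < b -> 0 <= x1 t * phi t - x t * phi1 t) ->
  x a / phi a <= x b / phi b.
Proof.
  intros Hab Hphi Hx Hpos HW.
  apply (nondecreasing_of_derive (fun t => x t / phi t)
          (fun t => (x1 t * phi t - x t * phi1 t) / phi t ^ 2)); [exact Hab| |].
  - intros t Ht. specialize (Hpos t Ht).
    apply (is_derive_div x phi t (x1 t) (phi1 t)); auto; lra.
  - intros t Ht. apply Rdiv_le_0_compat; [now apply HW|].
    apply pow_lt, Hpos; lra.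
Qed.

Lemma is_derive_wronskian (phi phi1 phi2 x x1 x2 : R -> R) (t : R) :
  is_derive phi t (phi1 t) -> is_derive phi1 t (phi2 t) ->
  is_derive x t (x1 t) -> is_derive x1 t (x2 t) ->
  is_derive (fun s => x1 s * phi s - x s * phi1 s) t (x2 t * phi t - x t * phi2 t).
Proof.
  intros H1 H2 H3 H4. auto_derive.
  - repeat split; eexists; eassumption.
  - use_derive H1. use_derive H2. use_derive H3. use_derive H4. ring.
Qed.

(** The Wronskian W has derivative h phi >= 0. If W(t) < 0 then W < 0 on the whole half-line before
    t, so x/phi is nonincreasing there and stays above its positive value at t, against x = o(phi)
    at -oo. Smallness of the ratio thus replaces a limit of W at -oo, which would require control of
    derivatives. *)
Lemma wronskian_nonneg (phi phi1 x x1 c h : R -> R) (t0 : R) :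
  (forall t, is_derive phi t (phi1 t)) ->
  (forall t, is_derive phi1 t (c t * phi t)) ->
  (forall t, 0 < phi t) ->
  (forall t, is_derive x t (x1 t)) ->
  (forall t, is_derive x1 t (c t * x t + h t)) ->
  (forall t, t <= t0 -> 0 < x t /\ 0 <= h t) ->
  (forall e, 0 < e -> exists T, forall t, t <= T -> x t <= e * phi t) ->
  forall t, t <= t0 -> 0 <= x1 t * phi t - x t * phi1 t.
Proof.
  intros Hphi Hphi1 Hpos Hx Hx1 Hnear Hlim t Ht.
  apply Rnot_lt_le. intros HW.
  assert (Hmon : forall s, s <= t -> x t / phi t <= x s / phi s).
  { intros s Hs.
    enough (- x s / phi s <= - x t / phi t) by (unfold Rdiv in *; lra).
    apply (wronskian_ratio phi phi1 (fun u => - x u) (fun u => - x1 u)); auto.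
    - intros u _. apply (is_derive_opp x), Hx.
    - intros u Hu.
      assert (x1 u * phi u - x u * phi1 u <= x1 t * phi t - x t * phi1 t); [|lra].
      apply (nondecreasing_of_derive (fun s => x1 s * phi s - x s * phi1 s)
              (fun s => (c s * x s + h s) * phi s - x s * (c s * phi s))); [lra| |].
      + intros v _. now apply (is_derive_wronskian phi phi1 (fun s => c s * phi s) x x1
          (fun s => c s * x s + h s)).
      + intros v Hv. destruct (Hnear v) as [_ Hh]; [lra|].
        specialize (Hpos v). nra. }
  destruct (Hnear t Ht) as [Hxt _].
  assert (Hq : 0 < x t / phi t) by (apply Rdiv_lt_0_compat; auto).
  destruct (Hlim (x t / phi t / 2)) as [T HT]; [lra|].
  set (s := Rmin T t).
  assert (Hs : s <= T /\ s <= t) by (split; [apply Rmin_l|apply Rmin_r]).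
  specialize (HT s (proj1 Hs)). specialize (Hmon s (proj2 Hs)).
  specialize (Hpos s).
  assert (x s / phi s <= x t / phi t / 2); [|lra].
  apply (Rmult_le_reg_r (phi s)); [exact Hpos|].
  unfold Rdiv at 1. rewrite Rmult_assoc, Rinv_l; lra.
Qed.

(** As long as x and y are positive, the nonnegative coefficients make both Wronskians with phi
    nondecreasing, hence nonnegative, and both ratios nondecreasing. The ratios at [t0] are then
    positive lower bounds, so neither function can reach 0 first. *)
Lemma cooperative_positive (phi phi1 x x1 y y1 c A A' B B' : R -> R) (t0 : R) :
  (forall t, is_derive phi t (phi1 t)) ->
  (forall t, is_derive phi1 t (c t * phi t)) ->
  (forall t, 0 < phi t) ->
  (forall t, is_derive x t (x1 t)) ->
  (forall t, is_derive x1 t (c t * x t + (A t * x t + B t * y t))) ->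
  (forall t, is_derive y t (y1 t)) ->
  (forall t, is_derive y1 t (c t * y t + (A' t * y t + B' t * x t))) ->
  (forall t, 0 <= A t /\ 0 <= B t /\ 0 <= A' t /\ 0 <= B' t) ->
  (forall t, t <= t0 -> 0 < x t /\ 0 < y t) ->
  (forall e, 0 < e -> exists T, forall t, t <= T -> x t <= e * phi t) ->
  (forall e, 0 < e -> exists T, forall t, t <= T -> y t <= e * phi t) ->
  (forall t, 0 < x t /\ 0 < y t) /\
  (forall s t, s <= t -> x s / phi s <= x t / phi t) /\
  (forall s t, s <= t -> y s / phi s <= y t / phi t).
Proof.
  intros Hphi Hphi1 Hpos Hx Hx1 Hy Hy1 Hcoef Hnear Hlimx Hlimy.
  set (W := fun x x1 s => x1 s * phi s - x s * phi1 s : R).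
  assert (HWx0 : forall t, t <= t0 -> 0 <= W x x1 t).
  { apply (wronskian_nonneg phi phi1 x x1 c (fun t => A t * x t + B t * y t)); auto.
    intros t Ht. destruct (Hnear t Ht), (Hcoef t) as [? [? [? ?]]]. split; [auto|nra]. }
  assert (HWy0 : forall t, t <= t0 -> 0 <= W y y1 t).
  { apply (wronskian_nonneg phi phi1 y y1 c (fun t => A' t * y t + B' t * x t)); auto.
    intros t Ht. destruct (Hnear t Ht), (Hcoef t) as [? [? [? ?]]]. split; [auto|nra]. }
  assert (HW : forall s, t0 <= s -> (forall u, t0 <= u < s -> 0 < x u /\ 0 < y u) ->
             0 <= W x x1 s /\ 0 <= W y y1 s).
  { intros s Hs Hu. split.
    - apply Rle_trans with (W x x1 t0); [apply HWx0; lra|].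
      apply (nondecreasing_of_derive (W x x1)
              (fun s => (c s * x s + (A s * x s + B s * y s)) * phi s - x s * (c s * phi s)));
        [lra| |].
      + intros v _. now apply (is_derive_wronskian phi phi1 (fun s => c s * phi s) x x1
          (fun s => c s * x s + (A s * x s + B s * y s))).
      + intros v Hv. destruct (Hu v) as [? ?]; [lra|].
        destruct (Hcoef v) as [? [? [? ?]]]. specialize (Hpos v).
        assert (0 <= (A v * x v + B v * y v) * phi v) by (apply Rmult_le_pos; nra). lra.
    - apply Rle_trans with (W y y1 t0); [apply HWy0; lra|].
      apply (nondecreasing_of_derive (W y y1)
              (fun s => (c s * y s + (A' s * y s + B' s * x s)) * phi s - y s * (c s * phi s)));
        [lra| |].
      + intros v _. now apply (is_derive_wronskian phi phi1 (fun s => c s * phi s) y y1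
          (fun s => c s * y s + (A' s * y s + B' s * x s))).
      + intros v Hv. destruct (Hu v) as [? ?]; [lra|].
        destruct (Hcoef v) as [? [? [? ?]]]. specialize (Hpos v).
        assert (0 <= (A' v * y v + B' v * x v) * phi v) by (apply Rmult_le_pos; nra). lra. }
  assert (HP : forall t, t0 <= t -> 0 < x t /\ 0 < y t).
  { apply real_induction. intros s Hs Hu.
    assert (HWs : forall v, t0 < v < s -> 0 <= W x x1 v /\ 0 <= W y y1 v).
    { intros v Hv. apply HW; [lra|]. intros w Hw. apply Hu. lra. }
    destruct (Hnear t0) as [Hx0 Hy0]; [lra|].
    (* Positivity strictly before [s] passes to [s] itself, with no loss in the limit, because x/phi
       has not decreased since [t0]; continuity then gains an interval to the right. *)
    assert (Hxs : 0 < x s).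
    { assert (x t0 / phi t0 <= x s / phi s).
      { apply (wronskian_ratio phi phi1 x x1); auto. intros v Hv. now apply HWs. }
      assert (0 < x t0 / phi t0) by (apply Rdiv_lt_0_compat; auto).
      replace (x s) with (x s / phi s * phi s) by (field; specialize (Hpos s); lra).
      apply Rmult_lt_0_compat; [lra|auto]. }
    assert (Hys : 0 < y s).
    { assert (y t0 / phi t0 <= y s / phi s).
      { apply (wronskian_ratio phi phi1 y y1); auto. intros v Hv. now apply HWs. }
      assert (0 < y t0 / phi t0) by (apply Rdiv_lt_0_compat; auto).
      replace (y s) with (y s / phi s * phi s) by (field; specialize (Hpos s); lra).
      apply Rmult_lt_0_compat; [lra|auto]. }
    destruct (continuity_pt_pos x s (is_derive_continuity_pt _ _ _ (Hx s)) Hxs) as [e1 [He1 H1]].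
    destruct (continuity_pt_pos y s (is_derive_continuity_pt _ _ _ (Hy s)) Hys) as [e2 [He2 H2]].
    exists (Rmin e1 e2). split; [now apply Rmin_pos|].
    intros u Hu'. pose proof (Rmin_l e1 e2). pose proof (Rmin_r e1 e2).
    split; [apply H1|apply H2]; rewrite Rabs_pos_eq; lra. }
  assert (HWall : forall t, 0 <= W x x1 t /\ 0 <= W y y1 t).
  { intros t. destruct (Rle_lt_dec t t0) as [Ht|Ht]; [auto|].
    apply HW; [lra|]. intros u Hu. apply HP. lra. }
  repeat split.
  - destruct (Rle_lt_dec t t0); [now apply Hnear | apply HP; lra].
  - destruct (Rle_lt_dec t t0); [now apply Hnear | apply HP; lra].
  - intros s t Hst. apply (wronskian_ratio phi phi1 x x1); auto. intros u _. apply HWall.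
  - intros s t Hst. apply (wronskian_ratio phi phi1 y y1); auto. intros u _. apply HWall.
Qed.

(** * Asymptotics at infinity *)

Lemma is_lim_infty_iff (g : R -> R) (l : R) :
  is_lim g p_infty l <->
  forall e, 0 < e -> exists T, forall t, T <= t -> Rabs (g t - l) <= e.
Proof.
  split.
  - intros H e He. apply is_lim_spec in H. destruct (H (mkposreal e He)) as [M HM].
    exists (M + 1). intros t Ht. apply Rlt_le, HM. lra.
  - intros H. apply is_lim_spec. intros e.
    destruct (H (e / 2)) as [T HT]; [destruct e; simpl; lra|].
    exists T. intros t Ht. apply Rle_lt_trans with (e / 2).
    + apply HT. lra.
    + destruct e; simpl; lra.
Qed.

Lemma exp_lt_1 (t : R) : t < exp t.
Proof.
  destruct (Rle_lt_dec t 0) as [H|H].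
  - pose proof (exp_pos t). lra.
  - pose proof (exp_ineq1 t). lra.
Qed.

Lemma scaled_exp_decay_small (C lam e : R) :
  0 < lam -> 0 < e -> exists T, forall t, T <= t -> C * exp (- (lam * t)) <= e.
Proof.
  (* The threshold comes from lam t < exp (lam t). *)
  intros Hlam He. exists (Rabs C / e / lam). intros t Ht.
  assert (Hc : Rabs C <= e * exp (lam * t)).
  { apply (Rmult_le_compat_r lam) in Ht; [|lra].
    unfold Rdiv in Ht. rewrite (Rmult_assoc _ (/ lam) lam), Rinv_l, Rmult_1_r in Ht by lra.
    apply (Rmult_le_compat_r e) in Ht; [|lra].
    rewrite Rmult_assoc, Rinv_l, Rmult_1_r in Ht by lra.
    pose proof (exp_lt_1 (lam * t)). nra. }
  rewrite exp_Ropp. pose proof (exp_pos (lam * t)) as Hp.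
  apply (Rmult_le_reg_r (exp (lam * t))); [exact Hp|].
  rewrite Rmult_assoc, Rinv_l, Rmult_1_r by lra.
  pose proof (Rle_abs C). lra.
Qed.

(** Once g <= lam e / 2, the product (M - e/2) exp (lam t) is nonincreasing, so M - e/2 is at most a
    decaying exponential. The one-sided form serves energies that satisfy only a differential
    inequality. *)
Lemma linear_decay_upper (M M1 g : R -> R) (lam T : R) :
  0 < lam ->
  (forall t, T <= t -> is_derive M t (M1 t)) ->
  (forall t, T <= t -> M1 t <= - lam * M t + g t) ->
  is_lim g p_infty 0 ->
  forall e, 0 < e -> exists T', forall t, T' <= t -> M t <= e.
Proof.
  intros Hlam Hd Hle Hg e He.
  rewrite is_lim_infty_iff in Hg.
  destruct (Hg (lam * e / 2)) as [T1 HT1]; [nra|].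
  set (T2 := Rmax T T1).
  assert (T <= T2 /\ T1 <= T2) as [H1 H2] by (split; [apply Rmax_l|apply Rmax_r]).
  set (C := (M T2 - e / 2) * exp (lam * T2)).
  destruct (scaled_exp_decay_small C lam (e / 2) Hlam) as [T3 HT3]; [lra|].
  exists (Rmax T2 T3). intros t Ht.
  assert (Ht2 : T2 <= t) by (pose proof (Rmax_l T2 T3); lra).
  assert (Ht3 : T3 <= t) by (pose proof (Rmax_r T2 T3); lra).
  assert (Hmon : (M t - e / 2) * exp (lam * t) <= C).
  { apply (nonincreasing_of_derive (fun s => (M s - e / 2) * exp (lam * s))
      (fun s => (M1 s + lam * (M s - e / 2)) * exp (lam * s))); [exact Ht2| |].
    - intros s Hs. assert (HM := Hd s ltac:(lra)).
      auto_derive; [eexists; eassumption|]. use_derive HM. ring.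
    - intros s Hs. pose proof (exp_pos (lam * s)).
      specialize (Hle s ltac:(lra)). specialize (HT1 s ltac:(lra)).
      rewrite Rminus_0_r in HT1. pose proof (Rle_abs (g s)). nra. }
  specialize (HT3 t Ht3). rewrite exp_Ropp in HT3.
  pose proof (exp_pos (lam * t)) as Hp.
  apply (Rmult_le_compat_r (/ exp (lam * t))) in Hmon;
    [|apply Rlt_le, Rinv_0_lt_compat, Hp].
  rewrite Rmult_assoc, Rinv_r, Rmult_1_r in Hmon by lra. lra.
Qed.

Lemma linear_decay (M g : R -> R) (lam T : R) :
  0 < lam ->
  (forall t, T <= t -> is_derive M t (- lam * M t + g t)) ->
  is_lim g p_infty 0 -> is_lim M p_infty 0.
Proof.
  intros Hlam Hd Hg. apply is_lim_infty_iff. intros e He.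
  destruct (linear_decay_upper M (fun t => - lam * M t + g t) g lam T Hlam Hd)
    with (e := e) as [T1 HT1]; auto.
  { intros; lra. }
  destruct (linear_decay_upper (fun t => - M t) (fun t => - (- lam * M t + g t))
    (fun t => - g t) lam T Hlam) with (e := e) as [T2 HT2]; auto.
  { intros t Ht. apply (is_derive_opp M), Hd, Ht. }
  { intros; lra. }
  { replace (Finite 0) with (Rbar_opp (Finite 0)) by (simpl; f_equal; ring).
    now apply is_lim_opp. }
  exists (Rmax T1 T2). intros t Ht. rewrite Rminus_0_r.
  pose proof (Rmax_l T1 T2). pose proof (Rmax_r T1 T2).
  specialize (HT1 t ltac:(lra)). specialize (HT2 t ltac:(lra)).
  apply Rabs_le. lra.
Qed.

Lemma linear_decay_to (M g : R -> R) (lam l T : R) :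
  0 < lam ->
  (forall t, T <= t -> is_derive M t (- lam * M t + g t)) ->
  is_lim g p_infty l -> is_lim M p_infty (l / lam).
Proof.
  intros Hlam Hd Hg.
  assert (H : is_lim (fun t => M t - l / lam) p_infty 0).
  { apply (linear_decay _ (fun t => g t - l) lam T Hlam).
    - intros t Ht. assert (HM := Hd t Ht).
      auto_derive; [eexists; eassumption|]. use_derive HM. field; lra.
    - apply is_lim_infty_iff. rewrite is_lim_infty_iff in Hg.
      intros e He. destruct (Hg e He) as [T1 HT1]. exists T1. intros t Ht.
      rewrite Rminus_0_r. auto. }
  rewrite is_lim_infty_iff in *. intros e He. destruct (H e He) as [T1 HT1].
  exists T1. intros t Ht. specialize (HT1 t Ht). now rewrite Rminus_0_r in HT1.
Qed.

Lemma nondecreasing_bounded_lim (g : R -> R) (T B : R) :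
  (forall s t, T <= s <= t -> g s <= g t) ->
  (forall t, T <= t -> g t <= B) ->
  exists l : R, is_lim g p_infty l.
Proof.
  intros Hmon Hb.
  destruct (completeness (fun v => exists t, T <= t /\ v = g t)) as [l [Hub Hlub]].
  - exists B. intros v [t [Ht ->]]. auto.
  - exists (g T), T. split; [lra|reflexivity].
  - exists l. apply is_lim_infty_iff. intros e He.
    assert (exists t, T <= t /\ l - e < g t) as [t0 [Ht0 Hg]].
    { apply NNPP. intros Hn. enough (l <= l - e) by lra.
      apply Hlub. intros v [t [Ht ->]]. apply Rnot_lt_le. intros Hlt.
      apply Hn. now exists t. }
    exists t0. intros t Ht.
    assert (g t <= l) by (apply Hub; exists t; split; [lra|reflexivity]).
    specialize (Hmon t0 t ltac:(lra)). apply Rabs_le. lra.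
Qed.

(** Since K/t^2 is the derivative of -K/t, the function al - K/t is nondecreasing and lies below the
    nonincreasing al + K/t; it converges, and K/t tends to 0. *)
Lemma lim_of_derive_inv_sqr (al al1 : R -> R) (K T : R) :
  0 < T ->
  (forall t, T <= t -> is_derive al t (al1 t)) ->
  (forall t, T <= t -> Rabs (al1 t) <= K / t ^ 2) ->
  exists l : R, is_lim al p_infty l.
Proof.
  intros HT Hd Hb.
  assert (HK : 0 <= K).
  { specialize (Hb T ltac:(lra)). pose proof (Rabs_pos (al1 T)).
    apply Rnot_lt_le. intros HK.
    assert (0 < - K / T ^ 2) by (apply Rdiv_lt_0_compat; [lra|apply pow_lt, HT]).
    unfold Rdiv in *. lra. }
  assert (Hinv : forall t, T <= t -> 0 <= K / t).
  { intros t Ht. apply Rdiv_le_0_compat; lra. }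
  destruct (nondecreasing_bounded_lim (fun t => al t - K / t) T (al T + K / T)) as [l Hl].
  - intros s t Hst.
    apply (nondecreasing_of_derive (fun t => al t - K / t) (fun t => al1 t + K / t ^ 2)); [lra| |].
    + intros u Hu. assert (HM := Hd u ltac:(lra)).
      auto_derive; [split; [eexists; eassumption|split; [lra|exact I]]|].
      use_derive HM. field; lra.
    + intros u Hu. specialize (Hb u ltac:(lra)). apply Rabs_le_between in Hb. lra.
  - intros t Ht.
    apply Rle_trans with (al t + K / t).
    { specialize (Hinv t Ht). lra. }
    apply (nonincreasing_of_derive (fun t => al t + K / t) (fun t => al1 t - K / t ^ 2)); [lra| |].
    + intros u Hu. assert (HM := Hd u ltac:(lra)).
      auto_derive; [split; [eexists; eassumption|split; [lra|exact I]]|].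
      use_derive HM. field; lra.
    + intros u Hu. specialize (Hb u ltac:(lra)). apply Rabs_le_between in Hb. lra.
  - exists l. rewrite is_lim_infty_iff in *. intros e He.
    destruct (Hl (e / 2)) as [T1 HT1]; [lra|].
    exists (Rmax T (Rmax T1 (2 * K / e))). intros t Ht.
    pose proof (Rmax_l T (Rmax T1 (2 * K / e))). pose proof (Rmax_r T (Rmax T1 (2 * K / e))).
    pose proof (Rmax_l T1 (2 * K / e)). pose proof (Rmax_r T1 (2 * K / e)).
    specialize (HT1 t ltac:(lra)). specialize (Hinv t ltac:(lra)).
    assert (K / t <= e / 2).
    { apply (Rmult_le_reg_r t); [lra|]. unfold Rdiv at 1. rewrite Rmult_assoc, Rinv_l by lra.
      assert (H3 : 2 * K / e <= t) by lra.
      apply (Rmult_le_compat_r e) in H3; [|lra]. unfold Rdiv in H3.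
      rewrite Rmult_assoc, Rinv_l in H3 by lra. lra. }
    apply Rabs_le_between in HT1. apply Rabs_le. lra.
Qed.

(** The integrating factor exp (K/t) stays between 1 and exp (K/T), because 1/t^2 is integrable at
    infinity. The lower version uses exp (-K/t) in the same way. *)
Lemma gronwall_inv_sqr (N N1 : R -> R) (K T : R) :
  0 < T -> 0 <= K ->
  (forall t, T <= t -> is_derive N t (N1 t)) ->
  (forall t, T <= t -> 0 <= N t) ->
  (forall t, T <= t -> N1 t <= K / t ^ 2 * N t) ->
  exists B, forall t, T <= t -> N t <= B.
Proof.
  intros HT HK Hd Hpos Hle. exists (N T * exp (K / T)). intros t Ht.
  apply Rle_trans with (N t * exp (K / t)).
  { assert (0 <= K / t) by (apply Rdiv_le_0_compat; lra).
    pose proof (exp_ineq1_le (K / t)). specialize (Hpos t Ht). nra. }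
  apply (nonincreasing_of_derive (fun t => N t * exp (K / t))
    (fun t => (N1 t - K / t ^ 2 * N t) * exp (K / t))); [lra| |].
  - intros u Hu. assert (HM := Hd u ltac:(lra)).
    auto_derive; [split; [eexists; eassumption|split; [lra|exact I]]|].
    use_derive HM. change (K * / u) with (K / u). field; lra.
  - intros u Hu. specialize (Hle u ltac:(lra)). pose proof (exp_pos (K / u)). nra.
Qed.

Lemma gronwall_inv_sqr_lower (N N1 : R -> R) (K T : R) :
  0 < T -> 0 <= K -> 0 < N T ->
  (forall t, T <= t -> is_derive N t (N1 t)) ->
  (forall t, T <= t -> 0 <= N t) ->
  (forall t, T <= t -> - (K / t ^ 2 * N t) <= N1 t) ->
  exists b, 0 < b /\ forall t, T <= t -> b <= N t.
Proof.
  intros HT HK HNT Hd Hpos Hle. exists (N T * exp (- (K / T))).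
  split; [apply Rmult_lt_0_compat; [exact HNT|apply exp_pos]|]. intros t Ht.
  apply Rle_trans with (N t * exp (- (K / t))).
  2:{ assert (0 <= K / t) by (apply Rdiv_le_0_compat; lra).
      assert (exp (- (K / t)) <= exp 0).
      { destruct (Req_dec (K / t) 0) as [->|]; [rewrite Ropp_0; lra|].
        apply Rlt_le, exp_increasing. lra. }
      rewrite exp_0 in *. specialize (Hpos t Ht). nra. }
  apply (nondecreasing_of_derive (fun t => N t * exp (- (K / t)))
    (fun t => (N1 t + K / t ^ 2 * N t) * exp (- (K / t)))); [lra| |].
  - intros u Hu. assert (HM := Hd u ltac:(lra)).
    auto_derive; [split; [eexists; eassumption|split; [lra|exact I]]|].
    use_derive HM. change (K * / u) with (K / u). field; lra.
  - intros u Hu. specialize (Hle u ltac:(lra)). pose proof (exp_pos (- (K / u))). nra.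
Qed.

Lemma sqrt2_facts : sqrt 2 * sqrt 2 = 2 /\ 1.4 < sqrt 2 < 1.5.
Proof.
  assert (H : sqrt 2 * sqrt 2 = 2) by (apply sqrt_sqrt; lra).
  pose proof (sqrt_pos 2). split; [exact H|split; nra].
Qed.

Lemma positive_of_convex (X1 X2 : R -> R) (delta T : R) :
  0 < delta ->
  (forall t, T <= t -> is_derive X1 t (X2 t)) ->
  (forall t, T <= t -> delta <= X2 t) ->
  exists T', T <= T' /\ forall t, T' <= t -> 0 <= X1 t.
Proof.
  intros Hdelta Hd Hle. exists (T + Rabs (X1 T) / delta).
  assert (0 <= Rabs (X1 T) / delta) by (apply Rdiv_le_0_compat; [apply Rabs_pos|lra]).
  split; [lra|]. intros t Ht.
  assert (H1 : X1 T - delta * T <= X1 t - delta * t).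
  { apply (nondecreasing_of_derive (fun t => X1 t - delta * t) (fun t => X2 t - delta)); [lra| |].
    - intros u Hu. assert (HM := Hd u ltac:(lra)).
      auto_derive; [eexists; eassumption|]. use_derive HM. ring.
    - intros u Hu. specialize (Hle u ltac:(lra)). lra. }
  assert (H2 : Rabs (X1 T) <= delta * (t - T)).
  { assert (H3 : Rabs (X1 T) / delta <= t - T) by lra.
    apply (Rmult_le_compat_r delta) in H3; [|lra].
    unfold Rdiv in H3. rewrite Rmult_assoc, Rinv_l in H3 by lra. lra. }
  pose proof (Rle_abs (- X1 T)). rewrite Rabs_Ropp in *. lra.
Qed.

Lemma Rabs_mult_le (a b A B : R) : Rabs a <= A -> Rabs b <= B -> Rabs (a * b) <= A * B.
Proof.
  intros Ha Hb. rewrite Rabs_mult.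
  apply Rmult_le_compat; auto using Rabs_pos.
Qed.

(* al and be below diagonalise X'' = 2 X; N is a Lyapunov function up to
   integrable errors, so al converges, and positivity bounds it away from 0. *)
Lemma coupled_exp_growth (X X1 Y Y1 q p w : R -> R) (K T delta : R) :
  let k := sqrt 2 in
  1 <= T -> 0 < delta ->
  (forall t, T <= t -> is_derive X t (X1 t)) ->
  (forall t, T <= t -> is_derive X1 t ((2 + q t) * X t + w t * Y t)) ->
  (forall t, T <= t -> is_derive Y t (Y1 t)) ->
  (forall t, T <= t -> is_derive Y1 t (p t * Y t + w t * X t)) ->
  (forall t, T <= t -> Rabs (q t) <= K / t ^ 2 /\ Rabs (p t) <= K / t ^ 2 /\
                       0 <= w t <= K / t ^ 2) ->
  (forall t, T <= t -> delta <= X t /\ 0 <= Y t) ->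
  exists l, 0 < l /\ is_lim (fun t => exp (- (k * t)) * X t) p_infty l /\
            is_lim (fun t => exp (- (k * t)) * Y t) p_infty 0.
Proof.
  intros k HT Hdelta HX HX1 HY HY1 Hcoef Hpos.
  destruct sqrt2_facts as [Hk2 Hk]. fold k in Hk2, Hk.
  assert (HK : 0 <= K).
  { destruct (Hcoef T) as [_ [_ Hw]]; [lra|].
    apply Rnot_lt_le. intros HK.
    assert (0 < - K / T ^ 2) by (apply Rdiv_lt_0_compat; [lra|apply pow_lt; lra]).
    unfold Rdiv in *. lra. }
  (* For t >= 1 + K one has K/t^2 <= 1, hence 2 + q >= 1 and X'' >= X >= delta; therefore X' is
     eventually nonnegative. *)
  set (T1 := T + K).
  assert (Hsmall : forall t, T1 <= t -> 0 <= K / t ^ 2 <= 1).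
  { intros t Ht. unfold T1 in Ht. split.
    - apply Rdiv_le_0_compat; [lra|apply pow_lt; lra].
    - apply (Rmult_le_reg_r (t ^ 2)); [apply pow_lt; lra|].
      unfold Rdiv. rewrite Rmult_assoc, Rinv_l by (apply pow_nonzero; lra). nra. }
  destruct (positive_of_convex X1 (fun t => (2 + q t) * X t + w t * Y t) delta T1)
    as [T2 [HT12 HX1pos]]; auto.
  { intros t Ht. apply HX1. unfold T1 in Ht; lra. }
  { intros t Ht. assert (T <= t) by (unfold T1 in Ht; lra).
    specialize (Hsmall t Ht). destruct (Hcoef t) as [Hq [_ Hw]]; [lra|].
    destruct (Hpos t) as [HXt HYt]; [lra|].
    apply Rabs_le_between in Hq.
    assert (0 <= w t * Y t) by (apply Rmult_le_pos; lra). nra. }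
  assert (HTT2 : T <= T2) by (unfold T1 in *; lra).
  (* After rescaling by e^(-k t), only [al] has no damping: [be] has rate 2k, and [eta], [zeta] have
     rate k with the coupling Y' = Y1. The remaining terms [e1], [e2] are O(1/t^2) times the
     unknowns. *)
  set (al := fun t => exp (- (k * t)) * (X1 t + k * X t)).
  set (be := fun t => exp (- (k * t)) * (X1 t - k * X t)).
  set (xi := fun t => exp (- (k * t)) * X t).
  set (eta := fun t => exp (- (k * t)) * Y t).
  set (zeta := fun t => exp (- (k * t)) * Y1 t).
  set (e1 := fun t => q t * xi t + w t * eta t).
  set (e2 := fun t => p t * eta t + w t * xi t).
  assert (Dal : forall t, T2 <= t -> is_derive al t (e1 t)).
  { intros t Ht. assert (H1 := HX t ltac:(lra)). assert (H2 := HX1 t ltac:(lra)).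
    unfold al, e1, xi, eta. auto_derive; [repeat split; eexists; eassumption|].
    use_derive H1. use_derive H2.
    replace 2 with (k * k) by exact Hk2. ring. }
  assert (Dbe : forall t, T2 <= t -> is_derive be t (- (2 * k) * be t + e1 t)).
  { intros t Ht. assert (H1 := HX t ltac:(lra)). assert (H2 := HX1 t ltac:(lra)).
    unfold be, e1, xi, eta. auto_derive; [repeat split; eexists; eassumption|].
    use_derive H1. use_derive H2.
    replace (2 + q t) with (k * k + q t) by (rewrite Hk2; ring). ring. }
  assert (Dxi : forall t, T2 <= t -> is_derive xi t (- (2 * k) * xi t + al t)).
  { intros t Ht. assert (H1 := HX t ltac:(lra)).
    unfold xi, al. auto_derive; [repeat split; eexists; eassumption|].
    use_derive H1. ring. }
  assert (Deta : forall t, T2 <= t -> is_derive eta t (- k * eta t + zeta t)).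
  { intros t Ht. assert (H1 := HY t ltac:(lra)).
    unfold eta, zeta. auto_derive; [repeat split; eexists; eassumption|].
    use_derive H1. ring. }
  assert (Dzeta : forall t, T2 <= t -> is_derive zeta t (- k * zeta t + e2 t)).
  { intros t Ht. assert (H1 := HY1 t ltac:(lra)).
    unfold zeta, e2, eta, xi. auto_derive; [repeat split; eexists; eassumption|].
    use_derive H1. ring. }
  set (S := fun t => Rabs (al t) + Rabs (be t) + Rabs (eta t) + Rabs (zeta t)).
  assert (Hxi : forall t, Rabs (xi t) <= Rabs (al t) + Rabs (be t)).
  { intros t.
    assert (H : 2 * k * xi t = al t - be t) by (unfold xi, al, be; ring).
    assert (H' : Rabs (2 * k * xi t) <= Rabs (al t) + Rabs (be t)).
    { rewrite H. unfold Rminus. rewrite <- (Rabs_Ropp (be t)). apply Rabs_triang. }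
    rewrite Rabs_mult, (Rabs_pos_eq (2 * k)) in H' by lra.
    pose proof (Rabs_pos (xi t)). nra. }
  assert (Habs : forall t, 0 <= Rabs (al t) /\ 0 <= Rabs (be t) /\ 0 <= Rabs (eta t) /\
                           0 <= Rabs (zeta t)).
  { intros t. repeat split; apply Rabs_pos. }
  assert (He1 : forall t, T2 <= t -> Rabs (e1 t) <= K / t ^ 2 * S t).
  { intros t Ht. unfold e1, S. destruct (Hcoef t) as [Hq [_ Hw]]; [lra|].
    specialize (Hxi t). specialize (Habs t).
    eapply Rle_trans; [apply Rabs_triang|].
    assert (H1 := Rabs_mult_le _ _ _ _ Hq Hxi).
    assert (H2 := Rabs_mult_le (w t) (eta t) (K / t ^ 2) _
      ltac:(rewrite Rabs_pos_eq; lra) (Rle_refl _)).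
    assert (0 <= K / t ^ 2) by lra. nra. }
  assert (He2 : forall t, T2 <= t -> Rabs (e2 t) <= K / t ^ 2 * S t).
  { intros t Ht. unfold e2, S. destruct (Hcoef t) as [_ [Hp Hw]]; [lra|].
    specialize (Hxi t). specialize (Habs t).
    eapply Rle_trans; [apply Rabs_triang|].
    assert (H1 := Rabs_mult_le (w t) (xi t) (K / t ^ 2) _
      ltac:(rewrite Rabs_pos_eq; lra) Hxi).
    assert (H2 := Rabs_mult_le (p t) (eta t) (K / t ^ 2) _ Hp (Rle_refl _)).
    assert (0 <= K / t ^ 2) by lra. nra. }
  set (N := fun t => al t ^ 2 + be t ^ 2 + eta t ^ 2 + zeta t ^ 2).
  assert (HSN : forall t, S t ^ 2 <= 4 * N t).
  { intros t. unfold S, N.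
    rewrite <- (pow2_abs (al t)), <- (pow2_abs (be t)), <- (pow2_abs (eta t)), <- (pow2_abs (zeta t)).
    specialize (Habs t).
    generalize dependent (Rabs (al t)). generalize dependent (Rabs (be t)).
    generalize dependent (Rabs (eta t)). generalize dependent (Rabs (zeta t)).
    intros a b c d _.
    pose proof (pow2_ge_0 (a - b)). pose proof (pow2_ge_0 (a - c)). pose proof (pow2_ge_0 (a - d)).
    pose proof (pow2_ge_0 (b - c)). pose proof (pow2_ge_0 (b - d)). pose proof (pow2_ge_0 (c - d)).
    nra. }
  assert (HN : exists B, forall t, T2 <= t -> N t <= B).
  { apply (gronwall_inv_sqr N
      (fun t => 2 * (al t + be t) * e1 t - 4 * k * be t ^ 2 - 2 * k * eta t ^ 2
                - 2 * k * zeta t ^ 2 + 2 * eta t * zeta t + 2 * zeta t * e2 t) (16 * K)); [lra|lra| | |].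
    - intros t Ht. assert (H1 := Dal t Ht). assert (H2 := Dbe t Ht).
      assert (H3 := Deta t Ht). assert (H4 := Dzeta t Ht).
      unfold N. auto_derive; [repeat split; eexists; eassumption|].
      use_derive H1. use_derive H2. use_derive H3. use_derive H4. ring.
    - intros t Ht. unfold N. nra.
    - intros t Ht. specialize (He1 t Ht). specialize (He2 t Ht). specialize (HSN t).
      assert (0 <= K / t ^ 2) by (destruct (Hcoef t) as [_ [_ Hw]]; lra).
      specialize (Habs t).
      assert (HS0 : Rabs (al t + be t) <= S t).
      { unfold S. pose proof (Rabs_triang (al t) (be t)). lra. }
      assert (HS1 : Rabs (zeta t) <= S t) by (unfold S; lra).
      assert (P1 := Rabs_mult_le _ _ _ _ HS0 He1).
      assert (P2 := Rabs_mult_le _ _ _ _ HS1 He2).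
      apply Rabs_le_between in P1. apply Rabs_le_between in P2.
      assert (HQ : K / t ^ 2 * S t ^ 2 <= K / t ^ 2 * (4 * N t)) by (apply Rmult_le_compat_l; lra).
      assert (HR : 16 * K / t ^ 2 * N t = 4 * (K / t ^ 2 * (4 * N t))) by (unfold Rdiv; ring).
      rewrite HR.
      assert (2 * eta t * zeta t <= eta t ^ 2 + zeta t ^ 2) by (pose proof (pow2_ge_0 (eta t - zeta t)); nra).
      pose proof (pow2_ge_0 (be t)). pose proof (pow2_ge_0 (eta t)). pose proof (pow2_ge_0 (zeta t)).
      assert (0 <= k * be t ^ 2) by nra.
      assert (eta t ^ 2 <= k * eta t ^ 2) by nra.
      assert (zeta t ^ 2 <= k * zeta t ^ 2) by nra. lra. }
  destruct HN as [B HB].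
  assert (HS : forall t, T2 <= t -> S t <= 1 + 4 * B).
  { intros t Ht. specialize (HB t Ht). specialize (HSN t). nra. }
  assert (HB0 : 0 <= 1 + 4 * B).
  { specialize (HS T2 ltac:(lra)). specialize (Habs T2). unfold S in HS. lra. }
  assert (He1' : forall t, T2 <= t -> Rabs (e1 t) <= K * (1 + 4 * B) / t ^ 2).
  { intros t Ht. eapply Rle_trans; [apply He1, Ht|].
    replace (K * (1 + 4 * B) / t ^ 2) with (K / t ^ 2 * (1 + 4 * B)) by (unfold Rdiv; ring).
    apply Rmult_le_compat_l; [|auto].
    destruct (Hcoef t) as [_ [_ Hw]]; lra. }
  destruct (lim_of_derive_inv_sqr al e1 (K * (1 + 4 * B)) T2) as [l Hl]; auto; [lra|].
  assert (Halpos : forall t, T2 <= t -> 0 <= k * xi t <= al t /\ 0 < al t).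
  { intros t Ht. unfold al, xi. pose proof (exp_pos (- (k * t))).
    destruct (Hpos t) as [HXt _]; [lra|]. specialize (HX1pos t Ht).
    assert (0 < k * X t) by nra.
    split; [|apply Rmult_lt_0_compat; lra].
    assert (0 <= exp (- (k * t)) * X1 t) by (apply Rmult_le_pos; lra).
    assert (0 <= exp (- (k * t)) * (k * X t)) by (apply Rmult_le_pos; lra). lra. }
  (* Positivity enters here: w eta >= 0, and X' >= 0 gives xi <= al, so al' >= -(K/t^2) al, an
     inequality in [al] alone. It bounds [al] below by a positive constant, hence l > 0. *)
  destruct (gronwall_inv_sqr_lower al e1 K T2) as [b [Hb0 Hb]]; auto; [lra|apply Halpos; lra| | |].
  { intros t Ht. apply Rlt_le, Halpos, Ht. }
  { intros t Ht. destruct (Hcoef t) as [Hq [_ Hw]]; [lra|].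
    destruct (Halpos t Ht) as [[Hx0 Hxa] _]. apply Rabs_le_between in Hq.
    destruct (Hpos t) as [_ HYt]; [lra|].
    assert (0 <= w t * eta t).
    { apply Rmult_le_pos; [lra|]. unfold eta. pose proof (exp_pos (- (k * t))). nra. }
    unfold e1.
    assert (0 <= xi t <= al t) by nra.
    assert (- (K / t ^ 2) * xi t <= q t * xi t) by (apply Rmult_le_compat_r; lra).
    assert (0 <= K / t ^ 2) by lra.
    assert (K / t ^ 2 * xi t <= K / t ^ 2 * al t) by (apply Rmult_le_compat_l; lra).
    lra. }
  exists (l / (2 * k)). split; [|split].
  - apply Rdiv_lt_0_compat; [|lra].
    apply Rlt_le_trans with (b / 2); [lra|]. apply Rnot_lt_le. intros Hlt.
    rewrite is_lim_infty_iff in Hl. destruct (Hl (b / 2)) as [T3 HT3]; [lra|].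
    specialize (HT3 (Rmax T2 T3) (Rmax_r _ _)). specialize (Hb (Rmax T2 T3) (Rmax_l _ _)).
    apply Rabs_le_between in HT3. lra.
  - apply (linear_decay_to xi al (2 * k) l T2); auto. lra.
  - apply is_lim_infty_iff. intros e He.
    (* With 2 eta zeta <= eta^2 + zeta^2 and k > 1, this energy decays at rate at least 1 up to an
       O(1/t^2) source: Y grows more slowly than e^(k t). *)
    destruct (linear_decay_upper (fun t => eta t ^ 2 + zeta t ^ 2)
      (fun t => - 2 * k * eta t ^ 2 - 2 * k * zeta t ^ 2 + 2 * eta t * zeta t + 2 * zeta t * e2 t)
      (fun t => 2 * K * (1 + 4 * B) * (1 + 4 * B) / t ^ 2) 1 T2) with (e := e ^ 2) as [T3 HT3]; [lra| | | | |].
    + intros t Ht. assert (H3 := Deta t Ht). assert (H4 := Dzeta t Ht).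
      auto_derive; [repeat split; eexists; eassumption|].
      use_derive H3. use_derive H4. ring.
    + intros t Ht. specialize (He2 t Ht). specialize (HS t Ht). specialize (Habs t).
      assert (0 <= K / t ^ 2) by (destruct (Hcoef t) as [_ [_ Hw]]; lra).
      assert (He3 : Rabs (e2 t) <= K / t ^ 2 * (1 + 4 * B)).
      { eapply Rle_trans; [exact He2|]. apply Rmult_le_compat_l; lra. }
      assert (HS1 : Rabs (zeta t) <= 1 + 4 * B) by (unfold S in HS; lra).
      assert (P2 := Rabs_mult_le _ _ _ _ HS1 He3).
      apply Rabs_le_between in P2.
      replace (2 * K * (1 + 4 * B) * (1 + 4 * B) / t ^ 2)
        with (2 * ((1 + 4 * B) * (K / t ^ 2 * (1 + 4 * B)))) by (unfold Rdiv; ring).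
      assert (2 * eta t * zeta t <= eta t ^ 2 + zeta t ^ 2) by (pose proof (pow2_ge_0 (eta t - zeta t)); nra).
      pose proof (pow2_ge_0 (eta t)). pose proof (pow2_ge_0 (zeta t)).
      assert (eta t ^ 2 <= k * eta t ^ 2) by nra.
      assert (zeta t ^ 2 <= k * zeta t ^ 2) by nra. lra.
    + set (C := 2 * K * (1 + 4 * B) * (1 + 4 * B)).
      assert (HC : 0 <= C) by (unfold C; repeat apply Rmult_le_pos; lra).
      apply is_lim_infty_iff. intros e' He'. exists (1 + C / e'). intros t Ht.
      assert (0 <= C / e') by (apply Rdiv_le_0_compat; lra).
      rewrite Rminus_0_r, Rabs_pos_eq.
      * apply (Rmult_le_reg_r (t ^ 2)); [apply pow_lt; lra|].
        unfold Rdiv. rewrite Rmult_assoc, Rinv_l by (apply pow_nonzero; lra).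
        assert (H3 : C / e' <= t) by lra.
        apply (Rmult_le_compat_r e') in H3; [|lra]. unfold Rdiv in H3.
        rewrite Rmult_assoc, Rinv_l in H3 by lra. nra.
      * apply Rdiv_le_0_compat; [exact HC|apply pow_lt; lra].
    + apply pow_lt; lra.
    + exists T3. intros t Ht. rewrite Rminus_0_r. specialize (HT3 t Ht). fold (eta t).
      pose proof (pow2_ge_0 (zeta t)).
      rewrite <- (Rabs_pos_eq e) by lra. apply Rsqr_le_abs_0.
      unfold Rsqr. nra.
Qed.

(* The lower bound c0 e^(-dt) with d < g2 excludes the decaying mode e^(-g2 t). *)
Lemma perturbed_exp_growth (V V1 U U1 h1 h2 : R -> R) (d g1 g2 c0 T : R) :
  0 < T -> 0 < d -> d < g2 -> 0 <= g1 -> 0 < c0 ->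
  (forall t, T <= t -> is_derive V t (V1 t)) ->
  (forall t, T <= t -> is_derive V1 t (g2 ^ 2 * V t + h1 t)) ->
  (forall t, T <= t -> is_derive U t (U1 t)) ->
  (forall t, T <= t -> is_derive U1 t (g1 ^ 2 * U t + h2 t)) ->
  (forall t, T <= t -> Rabs (h1 t) <= 2 / t ^ 2 * V t /\ Rabs (h2 t) <= 2 / t ^ 2 * V t) ->
  (forall t, T <= t -> c0 * exp (- (d * t)) <= V t) ->
  exists C, 0 < C /\ is_lim (fun t => exp (- (g2 * t)) * V t) p_infty C /\
    (g1 < g2 -> is_lim (fun t => exp (- (g2 * t)) * U t) p_infty 0).
Proof.
  intros HT Hd Hdg Hg1 Hc0 HV HV1 HU HU1 Hh Hlow.
  assert (HVpos : forall t, T <= t -> 0 < V t).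
  { intros t Ht. specialize (Hlow t Ht). pose proof (exp_pos (- (d * t))). nra. }
  (* An exponent strictly between d and g2: nu < g2 leaves room to absorb h1, so that V'' >= nu^2 V
     from [T1] on, and nu > d makes the lower bound incompatible with decay like e^(-nu t). *)
  set (nu := (d + g2) / 2).
  assert (Hgap : 0 < g2 ^ 2 - nu ^ 2) by (unfold nu; nra).
  set (T1 := T + 1 + 2 / (g2 ^ 2 - nu ^ 2)).
  assert (HT1 : T + 1 <= T1).
  { assert (0 <= 2 / (g2 ^ 2 - nu ^ 2)) by (apply Rdiv_le_0_compat; lra). unfold T1; lra. }
  assert (Hsup : forall t, T1 <= t -> nu ^ 2 * V t <= g2 ^ 2 * V t + h1 t).
  { intros t Ht. destruct (Hh t) as [H1 _]; [lra|]. apply Rabs_le_between in H1.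
    specialize (HVpos t ltac:(lra)).
    assert (2 / t ^ 2 <= g2 ^ 2 - nu ^ 2).
    { apply (Rmult_le_reg_r (t ^ 2)); [apply pow_lt; lra|].
      unfold Rdiv. rewrite Rmult_assoc, Rinv_l by (apply pow_nonzero; lra).
      assert (H3 : 2 / (g2 ^ 2 - nu ^ 2) <= t) by (unfold T1 in Ht; lra).
      apply (Rmult_le_compat_r (g2 ^ 2 - nu ^ 2)) in H3; [|lra]. unfold Rdiv in H3.
      rewrite Rmult_assoc, Rinv_l in H3 by lra.
      assert (1 <= t) by lra. nra. }
    nra. }
  (* Otherwise e^(nu t) V would be nonincreasing, so V = O(e^(-nu t)), against V >= c0 e^(-d t). *)
  assert (Hex : exists t1, T1 <= t1 /\ 0 < V1 t1 + nu * V t1).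
  { apply NNPP. intros Hn.
    assert (Hmon : forall t, T1 <= t -> exp (nu * t) * V t <= exp (nu * T1) * V T1).
    { intros t Ht.
      apply (nonincreasing_of_derive (fun t => exp (nu * t) * V t)
        (fun t => exp (nu * t) * (V1 t + nu * V t))); [lra| |].
      - intros u Hu. assert (H1 := HV u ltac:(lra)).
        auto_derive; [eexists; eassumption|]. use_derive H1. ring.
      - intros u Hu. pose proof (exp_pos (nu * u)).
        assert (V1 u + nu * V u <= 0); [|nra].
        apply Rnot_lt_le. intros Hlt. apply Hn. exists u. split; lra. }
    destruct (scaled_exp_decay_small (exp (nu * T1) * V T1) (nu - d) (c0 / 2))
      as [T2 HT2]; [unfold nu; lra|lra|].
    set (t := Rmax T1 T2).
    specialize (HT2 t (Rmax_r _ _)). specialize (Hmon t (Rmax_l _ _)).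
    specialize (Hlow t). pose proof (Rmax_l T1 T2). fold t in H.
    specialize (Hlow ltac:(lra)).
    assert (E1 : exp (nu * t) * exp (- (nu * t)) = 1)
      by (rewrite <- exp_plus, Rplus_opp_r; apply exp_0).
    assert (E2 : exp (- (d * t)) = exp (- (nu * t)) * exp ((nu - d) * t))
      by (rewrite <- exp_plus; f_equal; ring).
    assert (E3 : exp ((nu - d) * t) * exp (- ((nu - d) * t)) = 1)
      by (rewrite <- exp_plus, Rplus_opp_r; apply exp_0).
    rewrite E2 in Hlow.
    pose proof (exp_pos (nu * t)). pose proof (exp_pos ((nu - d) * t)).
    assert (Q1 : c0 * exp ((nu - d) * t) <= exp (nu * t) * V t).
    { apply (Rmult_le_compat_l (exp (nu * t))) in Hlow; [|lra].
      replace (c0 * exp ((nu - d) * t)) with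
        (c0 * exp ((nu - d) * t) * (exp (nu * t) * exp (- (nu * t)))) by (rewrite E1; ring). lra. }
    assert (Q2 : exp (nu * T1) * V T1 <= c0 / 2 * exp ((nu - d) * t)).
    { apply (Rmult_le_compat_r (exp ((nu - d) * t))) in HT2; [|lra].
      rewrite Rmult_assoc, (Rmult_comm (exp (- _))), E3 in HT2. lra. }
    nra. }
  destruct Hex as [t1 [Ht1 Hdel]].
  assert (HV1nd : forall s t, t1 <= s <= t -> V1 s <= V1 t).
  { intros s t Hst. apply (nondecreasing_of_derive V1 (fun t => g2 ^ 2 * V t + h1 t)); [lra| |].
    - intros u Hu. apply HV1; lra.
    - intros u Hu. specialize (Hsup u ltac:(lra)). specialize (HVpos u ltac:(lra)).
      pose proof (pow2_ge_0 nu). nra. }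
  assert (HP : forall t, t1 <= t -> exp (- (nu * t1)) * (V1 t1 + nu * V t1) * exp (nu * t)
                <= V1 t + nu * V t).
  { intros t Ht.
    assert (H : exp (- (nu * t1)) * (V1 t1 + nu * V t1) <= exp (- (nu * t)) * (V1 t + nu * V t)).
    { apply (nondecreasing_of_derive (fun t => exp (- (nu * t)) * (V1 t + nu * V t))
        (fun t => exp (- (nu * t)) * (g2 ^ 2 * V t + h1 t - nu ^ 2 * V t))); [lra| |].
      - intros u Hu. assert (H1 := HV u ltac:(lra)). assert (H2 := HV1 u ltac:(lra)).
        auto_derive; [repeat split; eexists; eassumption|]. use_derive H1. use_derive H2. ring.
      - intros u Hu. specialize (Hsup u ltac:(lra)).
        apply Rmult_le_pos; [apply Rlt_le, exp_pos|lra]. }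
    pose proof (exp_pos (nu * t)).
    apply (Rmult_le_compat_r (exp (nu * t))) in H; [|lra].
    replace (V1 t + nu * V t) with
      ((exp (nu * t) * exp (- (nu * t))) * (V1 t + nu * V t)); [lra|].
    rewrite <- exp_plus, Rplus_opp_r, exp_0. ring. }
  (* If V' stayed negative, V would remain below V(t1), while nu V >= V' + nu V grows at least like
     e^(nu t). *)
  assert (Hex2 : exists t2, t1 <= t2 /\ 0 <= V1 t2).
  { apply NNPP. intros Hn.
    assert (Hneg : forall t, t1 <= t -> V1 t < 0).
    { intros t Ht. apply Rnot_le_lt. intros Hle. apply Hn. now exists t. }
    set (D := exp (- (nu * t1)) * (V1 t1 + nu * V t1)) in *.
    assert (HD : 0 < D) by (apply Rmult_lt_0_compat; [apply exp_pos|lra]).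
    assert (Hnu : 0 < nu) by (unfold nu; lra).
    destruct (scaled_exp_decay_small (nu * V t1) nu (D / 2)) as [T2 HT2]; [lra|lra|].
    set (t := Rmax t1 T2).
    specialize (HT2 t (Rmax_r _ _)). specialize (HP t (Rmax_l _ _)).
    specialize (Hneg t (Rmax_l _ _)) as Hnt.
    assert (HVt : V t <= V t1).
    { apply (nonincreasing_of_derive V V1); [apply Rmax_l| |].
      - intros u Hu. apply HV. lra.
      - intros u Hu. apply Rlt_le, Hneg. lra. }
    pose proof (exp_pos (nu * t)).
    apply (Rmult_le_compat_r (exp (nu * t))) in HT2; [|lra].
    rewrite Rmult_assoc, <- exp_plus, Rplus_opp_l, exp_0 in HT2.
    nra. }
  destruct Hex2 as [t2 [Ht2 HV1t2]].
  assert (HV1pos : forall t, t2 <= t -> 0 <= V1 t).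
  { intros t Ht. specialize (HV1nd t2 t ltac:(lra)). lra. }
  assert (HTt2 : T <= t2) by lra.
  set (al := fun t => exp (- (g2 * t)) * (V1 t + g2 * V t)).
  set (be := fun t => exp (- (g2 * t)) * V t).
  set (e1 := fun t => exp (- (g2 * t)) * h1 t).
  assert (Dal : forall t, t2 <= t -> is_derive al t (e1 t)).
  { intros t Ht. assert (H1 := HV t ltac:(lra)). assert (H2 := HV1 t ltac:(lra)).
    unfold al, e1. auto_derive; [repeat split; eexists; eassumption|].
    use_derive H1. use_derive H2. ring. }
  assert (Dbe : forall t, t2 <= t -> is_derive be t (- (2 * g2) * be t + al t)).
  { intros t Ht. assert (H1 := HV t ltac:(lra)).
    unfold al, be. auto_derive; [repeat split; eexists; eassumption|].
    use_derive H1. ring. }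
  assert (Hbe : forall t, t2 <= t -> 0 < g2 * be t <= al t).
  { intros t Ht. unfold be, al. specialize (HVpos t ltac:(lra)). specialize (HV1pos t Ht).
    pose proof (exp_pos (- (g2 * t))).
    assert (0 < exp (- (g2 * t)) * V t) by (apply Rmult_lt_0_compat; lra).
    assert (0 <= exp (- (g2 * t)) * V1 t) by (apply Rmult_le_pos; lra).
    split; [nra|lra]. }
  (* From V' >= 0 one gets g2 be <= al, which turns |h1| <= (2/t^2) V into an error (K/t^2) al
     governed by [al] alone. *)
  set (K := 2 / g2).
  assert (HK : 0 <= K) by (apply Rdiv_le_0_compat; lra).
  assert (He1 : forall t, t2 <= t -> Rabs (e1 t) <= K / t ^ 2 * al t).
  { intros t Ht. destruct (Hh t) as [H1 _]; [lra|].
    unfold e1. rewrite Rabs_mult, Rabs_pos_eq by (apply Rlt_le, exp_pos).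
    apply Rle_trans with (K / t ^ 2 * (g2 * be t)).
    - replace (K / t ^ 2 * (g2 * be t)) with (exp (- (g2 * t)) * (2 / t ^ 2 * V t))
        by (unfold K, be; field; split; lra).
      apply Rmult_le_compat_l; [apply Rlt_le, exp_pos|exact H1].
    - apply Rmult_le_compat_l; [apply Rdiv_le_0_compat; [lra|apply pow_lt; lra]|].
      apply Hbe, Ht. }
  destruct (gronwall_inv_sqr al e1 K t2) as [B HB]; auto; [lra| | |].
  { intros t Ht. specialize (Hbe t Ht). lra. }
  { intros t Ht. specialize (He1 t Ht). apply Rabs_le_between in He1. lra. }
  destruct (gronwall_inv_sqr_lower al e1 K t2) as [b [Hb0 Hb]]; auto; [lra| | | |].
  { specialize (Hbe t2 ltac:(lra)). lra. }
  { intros t Ht. specialize (Hbe t Ht). lra. }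
  { intros t Ht. specialize (He1 t Ht). apply Rabs_le_between in He1. lra. }
  destruct (lim_of_derive_inv_sqr al e1 (K * B) t2) as [l Hl]; auto; [lra| |].
  { intros t Ht. eapply Rle_trans; [apply He1, Ht|].
    replace (K * B / t ^ 2) with (K / t ^ 2 * B) by (unfold Rdiv; ring).
    apply Rmult_le_compat_l; [apply Rdiv_le_0_compat; [lra|apply pow_lt; lra]|auto]. }
  exists (l / (2 * g2)). split; [|split].
  - apply Rdiv_lt_0_compat; [|lra].
    apply Rlt_le_trans with (b / 2); [lra|]. apply Rnot_lt_le. intros Hlt.
    rewrite is_lim_infty_iff in Hl. destruct (Hl (b / 2)) as [T3 HT3]; [lra|].
    specialize (HT3 (Rmax t2 T3) (Rmax_r _ _)). specialize (Hb (Rmax t2 T3) (Rmax_l _ _)).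
    apply Rabs_le_between in HT3. lra.
  - apply (linear_decay_to be al (2 * g2) l t2); auto. lra.
  - intros Hg12.
    (* Factoring D^2 - g1^2 as (D - g1)(D + g1) gives two first-order equations after rescaling by
       e^(-g2 t), with damping rates g2 - g1 and g2 + g1. The first rate is positive exactly because
       g1 < g2. *)
    set (p := fun t => exp (- (g2 * t)) * (U1 t + g1 * U t)).
    assert (Hp : is_lim p p_infty 0).
    { apply (linear_decay p (fun t => exp (- (g2 * t)) * h2 t) (g2 - g1) t2); [lra| |].
      - intros t Ht. assert (H1 := HU t ltac:(lra)). assert (H2 := HU1 t ltac:(lra)).
        unfold p. auto_derive; [repeat split; eexists; eassumption|].
        use_derive H1. use_derive H2. ring.
      - apply is_lim_infty_iff. intros e He.
        assert (HB0 : 0 <= B) by (specialize (HB t2 ltac:(lra)); specialize (Hbe t2 ltac:(lra)); lra).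
        assert (HKB : 0 <= K * B / e) by (apply Rdiv_le_0_compat; [apply Rmult_le_pos|]; lra).
        exists (t2 + 1 + K * B / e). intros t Ht. rewrite Rminus_0_r.
        destruct (Hh t) as [_ H2]; [lra|].
        rewrite Rabs_mult, Rabs_pos_eq by (apply Rlt_le, exp_pos).
        apply Rle_trans with (K / t ^ 2 * (g2 * be t)).
        + replace (K / t ^ 2 * (g2 * be t)) with (exp (- (g2 * t)) * (2 / t ^ 2 * V t))
            by (unfold K, be; field; split; lra).
          apply Rmult_le_compat_l; [apply Rlt_le, exp_pos|exact H2].
        + apply Rle_trans with (K / t ^ 2 * B).
          * apply Rmult_le_compat_l; [apply Rdiv_le_0_compat; [lra|apply pow_lt; lra]|].
            specialize (HB t ltac:(lra)). specialize (Hbe t ltac:(lra)). lra.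
          * apply (Rmult_le_reg_r (t ^ 2)); [apply pow_lt; lra|].
            replace (K / t ^ 2 * B * t ^ 2) with (K * B) by (field; lra).
            assert (H3 : K * B / e <= t) by lra.
            apply (Rmult_le_compat_r e) in H3; [|lra]. unfold Rdiv in H3.
            rewrite Rmult_assoc, Rinv_l in H3 by lra.
            assert (1 <= t) by lra. assert (0 < t * e) by (apply Rmult_lt_0_compat; lra).
            assert (t * e * 1 <= t * e * t) by (apply Rmult_le_compat_l; lra). lra. }
    apply (linear_decay _ p (g2 + g1) t2); [lra| |exact Hp].
    intros t Ht. assert (H1 := HU t ltac:(lra)).
    unfold p. auto_derive; [repeat split; eexists; eassumption|].
    use_derive H1. ring.
Qed.

(** * The vortex profile *)

(** With r = e^(s t) and s = 1 or -1, the second t-derivative is r^2 (u'' + u'/r) for either sign.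
    The sign chooses which end of (0,+oo) is sent to t = -oo, so that one comparison lemma serves
    both parts. *)
Lemma log_variable (s : R) (u : R -> R) :
  s * s = 1 -> twice_derivable_pos u ->
  let u1 := fun t => s * exp (s * t) * Derive u (exp (s * t)) in
  (forall t, is_derive (fun t => u (exp (s * t))) t (u1 t)) /\
  (forall t, is_derive u1 t (exp (s * t) ^ 2 * (Derive (Derive u) (exp (s * t)) +
                               Derive u (exp (s * t)) / exp (s * t)))).
Proof.
  intros Hs Hu u1. split; intros t; destruct (Hu (exp (s * t)) (exp_pos _)) as [H1 H2].
  - unfold u1. auto_derive; [exact H1|].
    replace (Derive (fun x : R => u x) (exp (s * t))) with (Derive u (exp (s * t))) by reflexivity.
    ring.
  - unfold u1. auto_derive; [exact H2|].
    replace (Derive (fun x : R => Derive u x) (exp (s * t)))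
      with (Derive (Derive u) (exp (s * t))) by reflexivity.
    field_simplify; [|apply Rgt_not_eq, exp_pos].
    replace (s ^ 2) with 1 by (rewrite <- Hs; ring). ring.
Qed.

Lemma interior_maximum (g g1 g2 : R -> R) (a b t1 : R) :
  (forall t, a <= t <= b -> is_derive g t (g1 t)) ->
  (forall t, a <= t <= b -> is_derive g1 t (g2 t)) ->
  a < t1 < b -> g a < g t1 -> g b < g t1 ->
  exists m, a < m < b /\ g t1 <= g m /\ g1 m = 0 /\ g2 m <= 0.
Proof.
  intros Hg Hg1 Ht1 Ha Hb.
  destruct (continuity_ab_maj g a b) as [m [Hmax Hm]]; [lra| |].
  { intros c Hc. eapply is_derive_continuity_pt, Hg, Hc. }
  assert (Hgm : g t1 <= g m) by (apply Hmax; lra).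
  assert (Ham : a < m < b).
  { split; (destruct (Req_dec m a) as [->|]; [lra|]); (destruct (Req_dec m b) as [->|]; lra). }
  exists m. split; [exact Ham|split; [exact Hgm|]].
  apply (derive_at_max g g1 g2 a m b); auto.
  - intros t Ht. apply Hg; lra.
  - intros t Ht. apply Hmax; lra.
Qed.

(** A positive value would produce a positive interior maximum, as g is nonpositive at T and has no
    positive limit values at infinity; strict convexity where g > 0 forbids it. *)
Lemma maximum_principle_infty (g g1 g2 : R -> R) (T : R) :
  (forall t, T <= t -> is_derive g t (g1 t)) ->
  (forall t, T <= t -> is_derive g1 t (g2 t)) ->
  g T <= 0 ->
  (forall t, T <= t -> 0 < g t -> 0 < g2 t) ->
  (forall e, 0 < e -> exists T', forall t, T' <= t -> g t <= e) ->
  forall t, T <= t -> g t <= 0.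
Proof.
  intros Hg Hg1 HT Hconv Hlim t1 Ht1. apply Rnot_lt_le. intros Hpos.
  destruct (Hlim (g t1 / 2)) as [T' HT']; [lra|].
  assert (T <> t1) by (intros ->; lra).
  pose proof (Rmax_l T' t1). pose proof (Rmax_r T' t1).
  destruct (interior_maximum g g1 g2 T (Rmax T' t1 + 1) t1) as [m [Hm [Hgm [_ H2]]]].
  - intros t Ht. apply Hg; lra.
  - intros t Ht. apply Hg1; lra.
  - lra.
  - lra.
  - specialize (HT' (Rmax T' t1 + 1) ltac:(lra)). lra.
  - specialize (Hconv m ltac:(lra) ltac:(lra)). lra.
Qed.

(** Forward uniqueness by energy: with |c| <= M on [a, t], the energy N = u^2 + u1^2 satisfies N' <=
    (1 + M) N and starts at 0. *)
Lemma linear_ode_zero (u u1 c : R -> R) (a : R) :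
  (forall t, is_derive u t (u1 t)) ->
  (forall t, is_derive u1 t (c t * u t)) ->
  (forall t, continuity_pt c t) ->
  u a = 0 -> u1 a = 0 -> forall t, a <= t -> u t = 0.
Proof.
  intros Hu Hu1 Hc H0 H1 t Ht.
  assert (exists M, 0 <= M /\ forall s, a <= s <= t -> Rabs (c s) <= M) as [M [HM0 HM]].
  { destruct (continuity_ab_maj (fun s => Rabs (c s)) a t Ht) as [m [Hm _]].
    - intros s _. apply (continuity_pt_comp c Rabs); [apply Hc|apply Rcontinuity_abs].
    - exists (Rabs (c m)). split; [apply Rabs_pos|exact Hm]. }
  set (N := fun s => u s ^ 2 + u1 s ^ 2).
  assert (HN : N t * exp (- ((1 + M) * t)) <= N a * exp (- ((1 + M) * a))).
  { apply (nonincreasing_of_derive (fun s => N s * exp (- ((1 + M) * s)))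
      (fun s => (2 * (1 + c s) * (u s * u1 s) - (1 + M) * N s) * exp (- ((1 + M) * s)))); [exact Ht| |].
    - intros s _. assert (D1 := Hu s). assert (D2 := Hu1 s).
      unfold N. auto_derive; [repeat split; eexists; eassumption|].
      use_derive D1. use_derive D2. ring.
    - intros s Hs. specialize (HM s ltac:(lra)). apply Rabs_le_between in HM.
      pose proof (exp_pos (- ((1 + M) * s))).
      assert (2 * (1 + c s) * (u s * u1 s) <= (1 + M) * N s); [|nra].
      pose proof (pow2_ge_0 (u s + u1 s)). pose proof (pow2_ge_0 (u s - u1 s)).
      assert (Hc1 : 2 * (u s * u1 s) <= N s) by (unfold N; lra).
      assert (Hc2 : - N s <= 2 * (u s * u1 s)) by (unfold N; lra).
      assert (P := Rabs_mult_le (1 + c s) (2 * (u s * u1 s)) (1 + M) (N s)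
        ltac:(apply Rabs_le; lra) ltac:(apply Rabs_le; lra)).
      apply Rabs_le_between in P. lra. }
  assert (HNa : N a = 0) by (unfold N; rewrite H0, H1; ring).
  rewrite HNa, Rmult_0_l in HN. pose proof (exp_pos (- ((1 + M) * t))).
  assert (HNt : N t <= 0) by (apply Rnot_lt_le; intros Hl; nra).
  unfold N in HNt. pose proof (pow2_ge_0 (u t)). pose proof (pow2_ge_0 (u1 t)).
  assert (Hz : u t ^ 2 = 0) by lra. nra.
Qed.

(** The functions K e^(-2t) and -K e^(-2t) are barriers for 1 - F: beyond them the restoring term
    e^(2t) (1 - F^2) F outweighs d^2 F and the curvature of the barrier. *)
Lemma log_profile_converges (d : R) (F F1 : R -> R) :
  0 < d ->
  (forall t, is_derive F t (F1 t)) ->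
  (forall t, is_derive F1 t ((d ^ 2 - exp (2 * t) * (1 - F t ^ 2)) * F t)) ->
  is_lim F p_infty 1 ->
  exists K T, 0 < K /\ forall t, T <= t ->
    Rabs (1 - F t) <= K * exp (- (2 * t)) /\ Rabs (F t - 1) <= 1 / 2.
Proof.
  intros Hd HF HF1 Hlim. rewrite is_lim_infty_iff in Hlim.
  destruct (Hlim (1 / 2)) as [T0 HT0]; [lra|].
  (* T >= 2 gives e^(-2t) <= 1/16, so the barrier curvature 4 K e^(-2t) is at most K/4. In [K]
     below, e^(2T) puts the barrier above |1 - F| at T, and 3 d^2 pays for d^2 F <= 3 d^2 / 2: since
     F (1 + F) >= 3/4, what remains is at least 3K/4 - K/4 - 3 d^2 / 2 > 0. *)
  set (T := Rmax T0 2).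
  assert (HTT : T0 <= T /\ 2 <= T) by (split; [apply Rmax_l|apply Rmax_r]).
  set (K := 3 * d ^ 2 + exp (2 * T)).
  assert (HK : 0 < K) by (unfold K; pose proof (exp_pos (2 * T)); nra).
  assert (Hhalf : forall t, T <= t -> 1 / 2 <= F t <= 3 / 2).
  { intros t Ht. specialize (HT0 t ltac:(lra)). apply Rabs_le_between in HT0. lra. }
  assert (Hsmall : forall t, T <= t -> exp (- (2 * t)) <= 1 / 16 /\
             exp (2 * t) * exp (- (2 * t)) = 1).
  { intros t Ht. assert (E : exp (2 * t) * exp (- (2 * t)) = 1)
      by (rewrite <- exp_plus, Rplus_opp_r; apply exp_0).
    split; [|exact E].
    assert (16 <= exp (2 * t)).
    { replace (2 * t) with (t / 2 + t / 2 + t / 2 + t / 2) by field. rewrite !exp_plus.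
      assert (2 <= exp (t / 2)) by (pose proof (exp_ineq1_le (t / 2)); lra).
      assert (4 <= exp (t / 2) * exp (t / 2)) by nra. nra. }
    pose proof (exp_pos (- (2 * t))). nra. }
  assert (HKT : 1 / 2 <= K * exp (- (2 * T))).
  { destruct (Hsmall T) as [_ E]; [lra|]. unfold K. rewrite Rmult_plus_distr_r, E.
    pose proof (exp_pos (- (2 * T))). pose proof (pow2_ge_0 d). nra. }
  assert (Hbar : forall e, 0 < e -> exists T', forall t, T' <= t ->
            Rabs (1 - F t) <= e).
  { intros e He. destruct (Hlim e He) as [T' HT']. exists T'. intros t Ht.
    rewrite Rabs_minus_sym. auto. }
  assert (Hup : forall t, T <= t -> 1 - F t - K * exp (- (2 * t)) <= 0).
  { apply (maximum_principle_infty _ (fun t => - F1 t + 2 * K * exp (- (2 * t)))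
      (fun t => - ((d ^ 2 - exp (2 * t) * (1 - F t ^ 2)) * F t) - 4 * K * exp (- (2 * t)))).
    - intros t Ht. assert (D := HF t). auto_derive; [eexists; eassumption|]. use_derive D. ring.
    - intros t Ht. assert (D := HF1 t). auto_derive; [eexists; eassumption|]. use_derive D. ring.
    - specialize (HT0 T ltac:(lra)). apply Rabs_le_between in HT0. lra.
    - intros t Ht Hpos. destruct (Hsmall t Ht) as [E1 E2]. specialize (Hhalf t Ht).
      assert (H2 : K <= exp (2 * t) * (1 - F t)).
      { pose proof (exp_pos (2 * t)). nra. }
      assert (H3 : K * (3 / 4) <= exp (2 * t) * (1 - F t) * (F t * (1 + F t))).
      { apply Rmult_le_compat; nra. }
      assert (3 * d ^ 2 <= K) by (unfold K; pose proof (exp_pos (2 * T)); lra).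
      assert (d ^ 2 * F t <= d ^ 2 * (3 / 2)) by (pose proof (pow2_ge_0 d); nra).
      pose proof (exp_pos (2 * T)). unfold K in *. nra.
    - intros e He. destruct (Hbar e He) as [T' HT']. exists T'. intros t Ht.
      specialize (HT' t Ht). apply Rabs_le_between in HT'.
      pose proof (exp_pos (- (2 * t))). nra. }
  assert (Hlow : forall t, T <= t -> F t - 1 - K * exp (- (2 * t)) <= 0).
  { apply (maximum_principle_infty _ (fun t => F1 t + 2 * K * exp (- (2 * t)))
      (fun t => ((d ^ 2 - exp (2 * t) * (1 - F t ^ 2)) * F t) - 4 * K * exp (- (2 * t)))).
    - intros t Ht. assert (D := HF t). auto_derive; [eexists; eassumption|]. use_derive D. ring.
    - intros t Ht. assert (D := HF1 t). auto_derive; [eexists; eassumption|]. use_derive D. ring.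
    - specialize (HT0 T ltac:(lra)). apply Rabs_le_between in HT0. lra.
    - intros t Ht Hpos. destruct (Hsmall t Ht) as [E1 E2]. specialize (Hhalf t Ht).
      assert (H2 : K <= exp (2 * t) * (F t - 1)).
      { pose proof (exp_pos (2 * t)). nra. }
      assert (H3 : K * (3 / 4) <= exp (2 * t) * (F t - 1) * (F t * (1 + F t))).
      { apply Rmult_le_compat; nra. }
      assert (0 <= d ^ 2 * F t) by (pose proof (pow2_ge_0 d); nra). nra.
    - intros e He. destruct (Hbar e He) as [T' HT']. exists T'. intros t Ht.
      specialize (HT' t Ht). apply Rabs_le_between in HT'.
      pose proof (exp_pos (- (2 * t))). nra. }
  exists K, T. split; [exact HK|]. intros t Ht.
  specialize (Hup t Ht). specialize (Hlow t Ht). split; [apply Rabs_le; lra|].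
  apply HT0; lra.
Qed.

(* Q is e^t times the deficit 1 - d^2 e^(-2t) - F^2.  A Pohozaev-type
   computation gives T' = - Q/2 (Q + 2 d^2 e^(-t)), so from a critical point
   with Q >= 0 on, T < 0 decreases and hence Q > 0 stays bounded away from 0,
   whereas Q tends to 0 at infinity. *)
Lemma log_profile_no_critical (d : R) (F F1 : R -> R) (p : R) :
  let Q := fun t => exp t - d ^ 2 * exp (- t) - exp t * F t ^ 2 in
  0 < d ->
  (forall t, is_derive F t (F1 t)) ->
  (forall t, is_derive F1 t ((d ^ 2 - exp (2 * t) * (1 - F t ^ 2)) * F t)) ->
  is_lim F p_infty 1 ->
  F1 p = 0 -> ~ 0 <= Q p.
Proof.
  intros Q Hd HF HF1 Hlim Hp HQp.
  (* Since F'' = -e^t Q F, the term F' F'' cancels against the part of -Q Q'/2 that contains F'. *)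
  set (T := fun t => F1 t ^ 2 / 2 - Q t ^ 2 / 4).
  assert (DQ : forall t, is_derive Q t (Q t + 2 * d ^ 2 * exp (- t) - 2 * exp t * F t * F1 t)).
  { intros t. assert (D := HF t). unfold Q. auto_derive; [eexists; eassumption|].
    use_derive D. ring. }
  assert (DT : forall t, is_derive T t (- (Q t / 2 * (Q t + 2 * d ^ 2 * exp (- t))))).
  { intros t. assert (D1 := HF1 t). assert (D2 := DQ t). unfold T.
    auto_derive; [repeat split; eexists; eassumption|]. use_derive D1. use_derive D2.
    replace (d ^ 2 - exp (2 * t) * (1 - F t ^ 2)) with (- (exp t * Q t)).
    - field.
    - unfold Q. replace (exp (2 * t)) with (exp t * exp t) by (rewrite <- exp_plus; f_equal; ring).
      assert (E : exp t * exp (- t) = 1) by (rewrite <- exp_plus, Rplus_opp_r; apply exp_0).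
      transitivity (- (exp t * exp t) * (1 - F t ^ 2) + d ^ 2 * (exp t * exp (- t))); [ring|].
      rewrite E. ring. }
  (* At the critical point Q' = Q + 2 d^2 e^(-p) > 0, so Q is strictly positive just after p even
     when Q(p) = 0. *)
  assert (Hd2 : forall t, 0 < 2 * d ^ 2 * exp (- t)).
  { intros t. pose proof (exp_pos (- t)). assert (0 < d ^ 2) by (apply pow_lt, Hd). nra. }
  destruct (derive_pos_right Q p _ (DQ p)) as [e [He HQe]].
  { rewrite Hp. specialize (Hd2 p). lra. }
  set (t1 := p + e / 2).
  assert (HT1 : T t1 < 0).
  { apply Rlt_le_trans with (T p).
    - enough (- T p < - T t1) by lra.
      apply (increasing_of_derive (fun t => - T t) (fun t => Q t / 2 * (Q t + 2 * d ^ 2 * exp (- t))));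
        [unfold t1; lra| |].
      + intros t _. assert (D := DT t). auto_derive; [eexists; eassumption|]. use_derive D. ring.
      + intros t Ht. unfold t1 in Ht. specialize (HQe t ltac:(lra)). specialize (Hd2 t).
        apply Rmult_lt_0_compat; lra.
    - unfold T. rewrite Hp. nra. }
  assert (Hdecr : forall s, t1 <= s -> (forall u, t1 <= u < s -> 0 < Q u) -> T s <= T t1).
  { intros s Hs Hu. apply (nonincreasing_of_derive T
      (fun t => - (Q t / 2 * (Q t + 2 * d ^ 2 * exp (- t))))); auto.
    intros t Ht. specialize (Hu t ltac:(lra)). specialize (Hd2 t).
    assert (0 < Q t / 2 * (Q t + 2 * d ^ 2 * exp (- t))) by (apply Rmult_lt_0_compat; lra). lra. }
  assert (HQpos : forall t, t1 <= t -> 0 < Q t).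
  { apply real_induction. intros s Hs Hu.
    assert (HQs : 0 < Q s).
    { destruct (Req_dec s t1) as [->|Hne]; [specialize (HQe t1); unfold t1 in *; lra|].
      assert (HTs := Hdecr s Hs Hu).
      (* At a zero of Q the energy is F'^2 / 2 >= 0, whereas it has stayed at or below T(t1) < 0. *)
      assert (Q s <> 0).
      { intros H0. unfold T at 1 in HTs. rewrite H0 in HTs. pose proof (pow2_ge_0 (F1 s)). nra. }
      apply Rnot_le_lt. intros Hle.
      destruct (continuity_pt_pos (fun t => - Q t) s) as [e' [He' Hneg]].
      - apply continuity_pt_opp. eapply is_derive_continuity_pt, DQ.
      - lra.
      - set (u := s - Rmin e' (s - t1) / 2).
        pose proof (Rmin_l e' (s - t1)). pose proof (Rmin_r e' (s - t1)).
        assert (0 < Rmin e' (s - t1)) by (apply Rmin_pos; lra).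
        specialize (Hneg u). specialize (Hu u). unfold u in *.
        rewrite Rabs_left in Hneg; lra. }
    destruct (continuity_pt_pos Q s) as [e' [He' H']]; auto.
    { eapply is_derive_continuity_pt, DQ. }
    exists e'. split; [exact He'|]. intros u Hu'. apply H'. rewrite Rabs_pos_eq; lra. }
  destruct (log_profile_converges d F F1) as [K [T0 [HK Hconv]]]; auto.
  set (del := - T t1) in *.
  (* From |1 - F| <= K e^(-2t) and 1 + F <= 3 one gets Q <= 3 K e^(-t). Once Q is at most 1 and at
     most 2 del, Q^2 / 4 <= del / 2, while T <= -del requires Q^2 / 4 >= del. *)
  destruct (scaled_exp_decay_small (3 * K) 1 (Rmin 1 (del * 2))) as [T2 HT2];
    [lra|apply Rmin_pos; unfold del; lra|].
  set (t := Rmax t1 (Rmax T0 T2)).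
  pose proof (Rmax_l t1 (Rmax T0 T2)). pose proof (Rmax_r t1 (Rmax T0 T2)).
  pose proof (Rmax_l T0 T2). pose proof (Rmax_r T0 T2). fold t in H, H0.
  specialize (HT2 t ltac:(lra)). specialize (Hconv t ltac:(lra)).
  destruct Hconv as [Hc1 Hc2]. apply Rabs_le_between in Hc1. apply Rabs_le_between in Hc2.
  specialize (HQpos t ltac:(lra)) as HQt.
  assert (HTt : T t <= T t1).
  { apply Hdecr; [lra|]. intros u Hu. apply HQpos. lra. }
  assert (HQb : Q t <= 3 * K * exp (- (1 * t))).
  { specialize (Hd2 t). unfold Q.
    replace (exp t - d ^ 2 * exp (- t) - exp t * F t ^ 2)
      with (exp t * ((1 - F t) * (1 + F t)) - d ^ 2 * exp (- t)) by ring.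
    assert (E : exp t * exp (- (2 * t)) = exp (- (1 * t))) by (rewrite <- exp_plus; f_equal; ring).
    rewrite <- E.
    assert ((1 - F t) * (1 + F t) <= K * exp (- (2 * t)) * 3).
    { pose proof (exp_pos (- (2 * t))). nra. }
    pose proof (exp_pos t). nra. }
  pose proof (Rmin_l 1 (del * 2)). pose proof (Rmin_r 1 (del * 2)).
  unfold T at 1 in HTt. pose proof (pow2_ge_0 (F1 t)).
  assert (Q t ^ 2 <= 1 * (del * 2)) by (replace (Q t ^ 2) with (Q t * Q t) by ring; apply Rmult_le_compat; lra).
  unfold del in *. lra.
Qed.

(** Suppose F(z) = 0. If F is nonzero somewhere before z, then F^2, which tends to 0 at -oo, has a
    positive interior maximum; there F' = 0 and the second-order condition says Q >= 0, which is
    excluded. If F vanishes identically before z, uniqueness makes it vanish forever, against the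
    limit 1. Without zeros, F has the sign of its limit. *)
Lemma log_profile_positive (d : R) (F F1 : R -> R) :
  0 < d ->
  (forall t, is_derive F t (F1 t)) ->
  (forall t, is_derive F1 t ((d ^ 2 - exp (2 * t) * (1 - F t ^ 2)) * F t)) ->
  (forall e, 0 < e -> exists T, forall t, t <= T -> Rabs (F t) <= e) ->
  is_lim F p_infty 1 ->
  forall t, 0 < F t.
Proof.
  intros Hd HF HF1 Hlim0 Hlim1.
  assert (Hcont : forall t, continuity_pt F t) by (intros t; eapply is_derive_continuity_pt, HF).
  assert (Hnz : forall z, F z <> 0).
  { intros z Hz.
    destruct (classic (exists t, t < z /\ F t <> 0)) as [[t [Htz Ht]]|Hall].
    - assert (0 < F t ^ 2) by (apply pow2_gt_0, Ht).
      assert (Hab : 0 < Rabs (F t)) by (apply Rabs_pos_lt, Ht).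
      destruct (Hlim0 (Rabs (F t) / 2)) as [T HT]; [lra|].
      pose proof (Rmin_l T t). pose proof (Rmin_r T t).
      specialize (HT (Rmin T t - 1) ltac:(lra)).
      destruct (interior_maximum (fun t => F t ^ 2) (fun t => 2 * F t * F1 t)
        (fun t => 2 * F1 t ^ 2 + 2 * F t * ((d ^ 2 - exp (2 * t) * (1 - F t ^ 2)) * F t))
        (Rmin T t - 1) z t) as [p [_ [Hp0 [Hp1 Hp2]]]].
      + intros s _. assert (D := HF s). auto_derive; [eexists; eassumption|]. use_derive D. ring.
      + intros s _. assert (D := HF s). assert (D2 := HF1 s).
        auto_derive; [repeat split; eexists; eassumption|]. use_derive D. use_derive D2. ring.
      + lra.
      + rewrite <- (pow2_abs (F (Rmin T t - 1))), <- (pow2_abs (F t)).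
        pose proof (Rabs_pos (F (Rmin T t - 1))). nra.
      + rewrite Hz. lra.
      + assert (HFp : F p <> 0) by (intros HF0; rewrite HF0 in Hp0; lra).
        assert (HF1p : F1 p = 0) by (apply Rmult_integral in Hp1; lra).
        apply (log_profile_no_critical d F F1 p Hd HF HF1 Hlim1 HF1p).
        rewrite HF1p in Hp2. assert (0 < F p ^ 2) by (apply pow2_gt_0, HFp).
        assert (HQ : d ^ 2 - exp (2 * p) * (1 - F p ^ 2) <= 0).
        { apply Rnot_lt_le. intros Hl. nra. }
        replace (exp (2 * p)) with (exp p * exp p) in HQ by (rewrite <- exp_plus; f_equal; ring).
        assert (E : exp p * exp (- p) = 1) by (rewrite <- exp_plus, Rplus_opp_r; apply exp_0).
        pose proof (exp_pos (- p)). pose proof (exp_pos p).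
        replace (exp p - d ^ 2 * exp (- p) - exp p * F p ^ 2)
          with (exp (- p) * (exp p * exp p * (1 - F p ^ 2) - d ^ 2)).
        * apply Rmult_le_pos; lra.
        * transitivity ((exp p * exp (- p)) * exp p * (1 - F p ^ 2) - d ^ 2 * exp (- p)); [ring|].
          rewrite E. ring.
    - assert (Hzero : forall t, t < z -> F t = 0).
      { intros t Ht. apply NNPP. intros Hn. apply Hall. now exists t. }
      assert (Hd0 : F1 (z - 1) = 0).
      { rewrite <- (is_derive_unique _ _ _ (HF (z - 1))).
        rewrite (Derive_ext_loc F (fun _ => 0)); [apply Derive_const|].
        exists (mkposreal 1 Rlt_0_1). intros y Hy. apply Hzero.
        apply Rabs_def2 in Hy. unfold minus, plus, opp in Hy; simpl in Hy. lra. }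
      assert (Hall0 : forall t, z - 1 <= t -> F t = 0).
      { apply (linear_ode_zero F F1 (fun t => d ^ 2 - exp (2 * t) * (1 - F t ^ 2))); auto.
        - intros t. apply (is_derive_continuity_pt _ _
            (- 2 * exp (2 * t) * (1 - F t ^ 2) + exp (2 * t) * (2 * F t * F1 t))).
          assert (D := HF t). auto_derive; [eexists; eassumption|]. use_derive D. ring.
        - apply Hzero. lra. }
      rewrite is_lim_infty_iff in Hlim1. destruct (Hlim1 (1 / 2)) as [T HT]; [lra|].
      specialize (HT (Rmax T (z - 1)) (Rmax_l _ _)).
      rewrite (Hall0 _ (Rmax_r _ _)), Rabs_left in HT; lra. }
  intros t. apply Rnot_le_lt. intros Hle.
  rewrite is_lim_infty_iff in Hlim1. destruct (Hlim1 (1 / 2)) as [T HT]; [lra|].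
  specialize (HT (Rmax T t) (Rmax_l _ _)). apply Rabs_le_between in HT.
  destruct (IVT_cor F t (Rmax T t)) as [z [_ Hz]]; [exact Hcont|apply Rmax_r|nra|].
  now apply (Hnz z).
Qed.

(** It suffices that G = e^(-d t) F be nonincreasing near -oo. Its derivative is e^(-2 d t) P, and P
    is nonincreasing where |F| <= 1. If P were positive at some t1, then G' would be at least m > 0
    on the whole half-line before t1, and G would become nonpositive. *)
Lemma log_profile_lower_bound (d : R) (F F1 : R -> R) :
  0 < d ->
  (forall t, is_derive F t (F1 t)) ->
  (forall t, is_derive F1 t ((d ^ 2 - exp (2 * t) * (1 - F t ^ 2)) * F t)) ->
  (forall e, 0 < e -> exists T, forall t, t <= T -> Rabs (F t) <= e) ->
  (forall t, 0 < F t) ->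
  exists c T, 0 < c /\ forall t, t <= T -> c * exp (d * t) <= F t.
Proof.
  intros Hd HF HF1 Hlim0 Hpos.
  destruct (Hlim0 1) as [T HT]; [lra|].
  set (P := fun t => exp (d * t) * (F1 t - d * F t)).
  assert (DP : forall s t, s <= t <= T -> P t <= P s).
  { intros s t Hst. apply (nonincreasing_of_derive P
      (fun t => - exp (d * t) * (exp (2 * t) * (1 - F t ^ 2)) * F t)); [lra| |].
    - intros u _. assert (D1 := HF u). assert (D2 := HF1 u). unfold P.
      auto_derive; [repeat split; eexists; eassumption|]. use_derive D1. use_derive D2. ring.
    - intros u Hu. specialize (HT u ltac:(lra)). apply Rabs_le_between in HT.
      specialize (Hpos u). pose proof (exp_pos (d * u)). pose proof (exp_pos (2 * u)).
      assert (0 <= exp (2 * u) * (1 - F u ^ 2)) by (apply Rmult_le_pos; nra).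
      assert (0 <= exp (d * u) * (exp (2 * u) * (1 - F u ^ 2)) * F u)
        by (apply Rmult_le_pos; [apply Rmult_le_pos|]; lra). lra. }
  set (G := fun t => exp (- (d * t)) * F t).
  set (G1 := fun t => exp (- (d * t)) * (F1 t - d * F t)).
  assert (DG : forall t, is_derive G t (G1 t)).
  { intros t. assert (D1 := HF t). unfold G, G1.
    auto_derive; [repeat split; eexists; eassumption|]. use_derive D1. ring. }
  assert (HGP : forall t, G1 t = exp (- (d * t)) ^ 2 * P t).
  { intros t. unfold G1, P.
    assert (E : exp (d * t) * exp (- (d * t)) = 1) by (rewrite <- exp_plus, Rplus_opp_r; apply exp_0).
    transitivity ((exp (d * t) * exp (- (d * t))) * (exp (- (d * t)) * (F1 t - d * F t)));
      [rewrite E|]; ring. }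
  assert (HP : forall t, t <= T -> P t <= 0).
  { intros t1 Ht1. apply Rnot_lt_le. intros Hlt.
    set (m := exp (- (d * t1)) ^ 2 * P t1).
    assert (Hm : 0 < m) by (apply Rmult_lt_0_compat; [apply pow_lt, exp_pos|exact Hlt]).
    assert (Hlin : forall t, t <= t1 -> G t - m * t <= G t1 - m * t1).
    { intros t Ht. apply (nondecreasing_of_derive (fun t => G t - m * t) (fun t => G1 t - m)); [lra| |].
      - intros u _. assert (D := DG u). auto_derive; [eexists; eassumption|]. use_derive D. ring.
      - intros u Hu. rewrite HGP. unfold m.
        specialize (DP u t1 ltac:(lra)).
        assert (exp (- (d * t1)) <= exp (- (d * u))) by (apply Rlt_le, exp_increasing; nra).
        pose proof (exp_pos (- (d * t1))).
        assert (exp (- (d * t1)) ^ 2 * P t1 <= exp (- (d * u)) ^ 2 * P u); [|lra].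
        apply Rmult_le_compat; [apply pow2_ge_0|lra| |exact DP].
        apply pow_incr. lra. }
    assert (HG1 : 0 < G t1) by (apply Rmult_lt_0_compat; [apply exp_pos|auto]).
    (* The point where the line of slope [m] through (t1, G t1) reaches 0. *)
    set (t := t1 - G t1 / m).
    assert (0 < G t1 / m) by (apply Rdiv_lt_0_compat; lra).
    specialize (Hlin t ltac:(unfold t; lra)).
    assert (HGt : 0 < G t) by (apply Rmult_lt_0_compat; [apply exp_pos|auto]).
    assert (m * t = m * t1 - G t1) by (unfold t; field; lra). lra. }
  exists (G T), T. split; [apply Rmult_lt_0_compat; [apply exp_pos|auto]|].
  intros t Ht.
  assert (H : G T <= G t).
  { apply (nonincreasing_of_derive G G1); [lra|auto|].
    intros u Hu. rewrite HGP. specialize (HP u ltac:(lra)). pose proof (pow2_ge_0 (exp (- (d * u)))). nra. }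
  pose proof (exp_pos (d * t)).
  apply (Rmult_le_compat_r (exp (d * t))) in H; [|lra].
  unfold G at 2 in H.
  replace (exp (- (d * t)) * F t * exp (d * t)) with (F t * (exp (d * t) * exp (- (d * t)))) in H by ring.
  rewrite <- exp_plus, Rplus_opp_r, exp_0 in H. lra.
Qed.

(** * Solutions of the system *)

Lemma at_right_0_iff (P : R -> Prop) :
  at_right 0 P <-> exists e, 0 < e /\ forall r, 0 < r < e -> P r.
Proof.
  unfold at_right, within. split.
  - intros [e He]. exists e. split; [apply cond_pos|]. intros r Hr. apply He; [|lra].
    change (Rabs (r - 0) < e). rewrite Rminus_0_r, Rabs_pos_eq; lra.
  - intros [e [He H]]. exists (mkposreal e He). intros r Hr Hr0. apply H. split; [exact Hr0|].
    change (Rabs (r - 0) < e) in Hr. apply Rabs_def2 in Hr. lra.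
Qed.

Lemma is_sim_bound (F : (R -> Prop) -> Prop) (FF : Filter F) (h g : R -> R) (e : R) :
  is_sim F h g -> 0 < e -> F (fun r => Rabs (h r - g r) <= e * Rabs (g r)).
Proof.
  intros [g0 [Hlim [C [HC HO]]]] He.
  assert (HeC : 0 < e / C) by (apply Rdiv_lt_0_compat; lra).
  assert (H := proj1 (filterlim_locally g0 0) Hlim (mkposreal _ HeC)).
  generalize (filter_and _ _ HO H). apply filter_imp. intros r [H1 H2].
  change (Rabs (g0 r - 0) < e / C) in H2. rewrite Rminus_0_r in H2.
  rewrite Rabs_Rabsolu in H1. eapply Rle_trans; [exact H1|].
  rewrite Rabs_mult. pose proof (Rabs_pos (g r)).
  replace (e * Rabs (g r)) with (C * (Rabs (g r) * (e / C))) by (field; lra).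
  apply Rmult_le_compat_l; [lra|]. apply Rmult_le_compat_l; lra.
Qed.

(** The relative error h/g - 1 serves as the vanishing factor, with constant 1. *)
Lemma is_sim_intro (F : (R -> Prop) -> Prop) (FF : Filter F) (h g : R -> R) :
  F (fun r => g r <> 0) ->
  (forall e, 0 < e -> F (fun r => Rabs (h r / g r - 1) <= e)) -> is_sim F h g.
Proof.
  intros Hg Hlim. exists (fun r => h r / g r - 1). split.
  - apply filterlim_locally. intros e.
    assert (He : 0 < e / 2) by (destruct e; simpl; lra).
    generalize (Hlim _ He). apply filter_imp. intros r Hr.
    change (Rabs (h r / g r - 1 - 0) < e). rewrite Rminus_0_r. lra.
  - exists 1. split; [lra|]. generalize Hg. apply filter_imp. intros r Hr.
    rewrite Rabs_Rabsolu, Rmult_1_l. right. f_equal. field. exact Hr.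
Qed.

Lemma Rpower_exp (t g : R) : Rpower (exp t) g = exp (g * t).
Proof. unfold Rpower. now rewrite ln_exp. Qed.

Lemma is_derive_eq (g : R -> R) (t l l' : R) : is_derive g t l -> l = l' -> is_derive g t l'.
Proof. now intros H <-. Qed.

Lemma log_profile_equation (s d : R) (f : R -> R) :
  s * s = 1 -> is_vortex_profile d f ->
  exists F1 : R -> R,
    (forall t, is_derive (fun t => f (exp (s * t))) t (F1 t)) /\
    (forall t, is_derive F1 t
       ((d ^ 2 - exp (s * t) ^ 2 * (1 - f (exp (s * t)) ^ 2)) * f (exp (s * t)))).
Proof.
  intros Hs [Hf [Heq _]]. destruct (log_variable s f Hs Hf) as [H1 H2].
  eexists. split; [exact H1|]. intros t. eapply is_derive_eq; [apply H2|].
  pose proof (exp_pos (s * t)) as Hr. specialize (Heq _ Hr).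
  set (r := exp (s * t)) in *. clearbody r.
  replace (Derive (Derive f) r + Derive f r / r)
    with (d ^ 2 / r ^ 2 * f r - f r * (1 - f r ^ 2)) by lra.
  field. lra.
Qed.

Lemma log_system_equation (s gamma1 gamma2 : R) (f a b : R -> R) :
  s * s = 1 -> is_solution_S gamma1 gamma2 f a b ->
  exists A1 B1 : R -> R,
    (forall t, is_derive (fun t => a (exp (s * t))) t (A1 t)) /\
    (forall t, is_derive (fun t => b (exp (s * t))) t (B1 t)) /\
    (forall t, is_derive A1 t (gamma1 ^ 2 * a (exp (s * t)) + exp (s * t) ^ 2 *
       ((2 * f (exp (s * t)) ^ 2 - 1) * a (exp (s * t)) + f (exp (s * t)) ^ 2 * b (exp (s * t))))) /\
    (forall t, is_derive B1 t (gamma2 ^ 2 * b (exp (s * t)) + exp (s * t) ^ 2 *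
       ((2 * f (exp (s * t)) ^ 2 - 1) * b (exp (s * t)) + f (exp (s * t)) ^ 2 * a (exp (s * t))))).
Proof.
  intros Hs [Ha [Hb Heq]].
  destruct (log_variable s a Hs Ha) as [Ha1 Ha2].
  destruct (log_variable s b Hs Hb) as [Hb1 Hb2].
  do 2 eexists. split; [exact Ha1|split; [exact Hb1|split]]; intros t.
  - eapply is_derive_eq; [apply Ha2|].
    pose proof (exp_pos (s * t)) as Hr. destruct (Heq _ Hr) as [E _].
    set (r := exp (s * t)) in *. clearbody r.
    replace (Derive (Derive a) r + Derive a r / r)
      with (gamma1 ^ 2 / r ^ 2 * a r + f r ^ 2 * b r + f r ^ 2 * a r - (1 - f r ^ 2) * a r) by lra.
    field. lra.
  - eapply is_derive_eq; [apply Hb2|].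
    pose proof (exp_pos (s * t)) as Hr. destruct (Heq _ Hr) as [_ E].
    set (r := exp (s * t)) in *. clearbody r.
    replace (Derive (Derive b) r + Derive b r / r)
      with (gamma2 ^ 2 / r ^ 2 * b r + f r ^ 2 * a r + f r ^ 2 * b r - (1 - f r ^ 2) * b r) by lra.
    field. lra.
Qed.

(** Translates the facts in t = ln r back to r. The power r^d is written [exp (d * ln r)], which
    reduces to an exponential under r = e^(s t). *)
Lemma vortex_profile_bounds (d : R) (f : R -> R) :
  0 < d -> is_vortex_profile d f ->
  (forall r, 0 < r -> 0 < f r) /\
  (exists c R, 0 < c /\ 0 < R /\
     forall r, 0 < r <= R -> c * exp (d * ln r) <= f r /\ f r <= 1) /\
  (exists K R, 0 < K /\ 1 <= R /\
     forall r, R <= r -> Rabs (1 - f r) <= K / r ^ 2 /\ 1 / 2 <= f r <= 3 / 2).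
Proof.
  intros Hd Hf.
  destruct (log_profile_equation 1 d f ltac:(lra) Hf) as [F1 [HF HF1]].
  destruct Hf as [_ [_ [Hlim0 Hlim1]]].
  set (F := fun t => f (exp (1 * t))) in *.
  assert (HF1' : forall t, is_derive F1 t ((d ^ 2 - exp (2 * t) * (1 - F t ^ 2)) * F t)).
  { intros t. eapply is_derive_eq; [apply HF1|]. unfold F.
    replace (exp (2 * t)) with (exp (1 * t) ^ 2); [reflexivity|].
    simpl. rewrite Rmult_1_r, <- exp_plus. f_equal. ring. }
  assert (L0 : forall e, 0 < e -> exists T, forall t, t <= T -> Rabs (F t) <= e).
  { intros e He. assert (H := proj1 (filterlim_locally f 0) Hlim0 (mkposreal e He)).
    apply at_right_0_iff in H. destruct H as [e' [He' H]].
    exists (ln e' - 1). intros t Ht. unfold F. rewrite Rmult_1_l.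
    assert (exp t < e').
    { rewrite <- (exp_ln e') by exact He'. apply exp_increasing. lra. }
    specialize (H (exp t) (conj (exp_pos t) H0)).
    change (Rabs (f (exp t) - 0) < e) in H. rewrite Rminus_0_r in H. lra. }
  assert (L1 : is_lim F p_infty 1).
  { apply is_lim_infty_iff. rewrite is_lim_infty_iff in Hlim1.
    intros e He. destruct (Hlim1 e He) as [T HT]. exists T. intros t Ht.
    apply HT. unfold F. rewrite Rmult_1_l. pose proof (exp_lt_1 t). lra. }
  assert (HFpos := log_profile_positive d F F1 Hd HF HF1' L0 L1).
  assert (Eln : forall r, 0 < r -> F (ln r) = f r).
  { intros r Hr. unfold F. now rewrite Rmult_1_l, exp_ln. }
  assert (Hle : forall T r, 0 < r -> r <= exp T -> ln r <= T).
  { intros T r Hr HrT. rewrite <- (ln_exp T). destruct HrT as [HrT|HrT].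
    - apply Rlt_le, ln_increasing; assumption.
    - rewrite HrT. lra. }
  assert (Hge : forall T r, exp T <= r -> T <= ln r).
  { intros T r HrT. pose proof (exp_pos T). rewrite <- (ln_exp T) at 1. destruct HrT as [HrT|HrT].
    - apply Rlt_le, ln_increasing; assumption.
    - rewrite HrT. lra. }
  split; [|split].
  - intros r Hr. rewrite <- Eln by exact Hr. apply HFpos.
  - destruct (log_profile_lower_bound d F F1 Hd HF HF1' L0 HFpos) as [c [T [Hc HT]]].
    destruct (L0 1) as [T' HT']; [lra|].
    exists c, (Rmin (exp T) (exp T')). split; [exact Hc|split; [apply Rmin_pos; apply exp_pos|]].
    intros r [Hr HrR]. pose proof (Rmin_l (exp T) (exp T')). pose proof (Rmin_r (exp T) (exp T')).
    rewrite <- Eln by exact Hr. split.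
    + apply HT, Hle; lra.
    + eapply Rle_trans; [apply Rle_abs|]. apply HT', Hle; lra.
  - destruct (log_profile_converges d F F1 Hd HF HF1' L1) as [K [T [HK HT]]].
    exists K, (exp T + 1). split; [exact HK|split; [pose proof (exp_pos T); lra|]].
    intros r Hr. pose proof (exp_pos T). assert (Hr0 : 0 < r) by lra.
    destruct (HT (ln r)) as [H1 H2]; [apply Hge; lra|].
    rewrite Eln in H1, H2 by exact Hr0. split.
    + replace (K / r ^ 2) with (K * exp (- (2 * ln r))); [exact H1|].
      rewrite exp_Ropp. replace (2 * ln r) with (ln r + ln r) by ring.
      rewrite exp_plus, exp_ln by exact Hr0. unfold Rdiv. do 2 f_equal. ring.
    + apply Rabs_le_between in H2. lra.
Qed.

(** The factor sqrt r removes the first-order term at the cost of -1/(4 r^2). It accounts for the 1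
    / sqrt r in [exp_growth] and for the shift G - 1/4 used later. *)
Lemma sqrt_variable (u : R -> R) :
  twice_derivable_pos u ->
  let u1 := fun r => sqrt r * Derive u r + u r / (2 * sqrt r) in
  forall r, 0 < r -> is_derive (fun r => sqrt r * u r) r (u1 r) /\
    is_derive u1 r (sqrt r * (Derive (Derive u) r + Derive u r / r) - sqrt r * u r / (4 * r ^ 2)).
Proof.
  intros Hu u1 r Hr. destruct (Hu r Hr) as [H1 H2].
  pose proof (sqrt_lt_R0 r Hr) as Hs. assert (Hs2 := sqrt_sqrt r (Rlt_le _ _ Hr)).
  split.
  - unfold u1. auto_derive; [split; [exact Hr|split; [exact H1|exact I]]|].
    replace (Derive (fun x : R => u x) r) with (Derive u r) by reflexivity.
    field. lra.
  - unfold u1. auto_derive.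
    { repeat split; auto. lra. }
    replace (Derive (fun x : R => u x) r) with (Derive u r) by reflexivity.
    replace (Derive (fun x : R => Derive u x) r) with (Derive (Derive u) r) by reflexivity.
    set (w := sqrt r) in *. rewrite <- Hs2. field. lra.
Qed.

Lemma Rdiv_small (C e r : R) : 0 < e -> 0 <= C -> C / e + 1 <= r -> C / r <= e /\ 1 <= r.
Proof.
  intros He HC Hr. assert (0 <= C / e) by (apply Rdiv_le_0_compat; lra).
  split; [|lra]. apply (Rmult_le_reg_r r); [lra|].
  unfold Rdiv. rewrite Rmult_assoc, Rinv_l by lra.
  assert (H3 : C / e <= r) by lra. apply (Rmult_le_compat_r e) in H3; [|lra].
  unfold Rdiv in H3. rewrite Rmult_assoc, Rinv_l in H3 by lra. lra.
Qed.

(** The crude bound 1/r suffices to make the ratios to [f] tend to 0, as [f] stays above 1/2 near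
    infinity. *)
Lemma exp_decay_bound (r : R) : 1 <= r -> 0 < exp_decay r <= / r.
Proof.
  intros Hr. unfold exp_decay. destruct sqrt2_facts as [_ Hk].
  assert (Hs : 1 <= sqrt r) by (rewrite <- sqrt_1; apply sqrt_le_1; lra).
  assert (Hp := exp_pos (- sqrt 2 * r)).
  split; [apply Rdiv_lt_0_compat; lra|].
  apply Rle_trans with (exp (- sqrt 2 * r)).
  - apply (Rmult_le_reg_r (sqrt r)); [lra|]. unfold Rdiv.
    rewrite Rmult_assoc, Rinv_l by lra. nra.
  - replace (- sqrt 2 * r) with (- (sqrt 2 * r)) by ring. rewrite exp_Ropp.
    apply Rinv_le_contravar; [lra|]. pose proof (exp_lt_1 (sqrt 2 * r)). nra.
Qed.

(** Comparison runs in t = -ln r, starting from infinity, and yields |u| <= v and u + v >= m f. Near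
    0 the first makes the f-terms perturbations controlled by v, and the second gives v >= const
    r^d, which rules out the mode r^gamma2 as d < gamma2. *)
Lemma decaying_solution_at_0 (d gamma1 gamma2 : R) (f u v : R -> R) :
  0 < d -> 0 <= gamma1 -> gamma1 <= gamma2 ->
  d ^ 2 < (gamma1 ^ 2 + gamma2 ^ 2) / 2 ->
  is_vortex_profile d f ->
  is_solution_S gamma1 gamma2 f u v ->
  is_sim (Rbar_locally p_infty) u exp_decay ->
  is_sim (Rbar_locally p_infty) v exp_decay ->
  exists C : R, C <> 0 /\
    (gamma1 < gamma2 -> is_littleo (at_right 0) u (fun r => Rpower r (- gamma2))) /\
    is_sim (at_right 0) v (fun r => C * Rpower r (- gamma2)).
Proof.
  intros Hd Hg1 Hg12 HG Hf Hsol Hu Hv.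
  destruct (vortex_profile_bounds d f Hd Hf) as [Hfpos [[c [R0 [Hc [HR0 Hf0]]]] [K [Rinf [HK [HRinf Hfinf]]]]]].
  destruct (log_profile_equation (-1) d f ltac:(lra) Hf) as [F1 [HF HF1]].
  destruct (log_system_equation (-1) _ _ f u v ltac:(lra) Hsol) as [U1 [V1 [HU [HV [HU1 HV1]]]]].
  set (G := (gamma1 ^ 2 + gamma2 ^ 2) / 2) in *.
  set (D := (gamma2 ^ 2 - gamma1 ^ 2) / 2).
  assert (HD : 0 <= D) by (unfold D; nra).
  set (r := fun t => exp (-1 * t)) in *.
  assert (Hr : forall t, 0 < r t) by (intros; apply exp_pos).
  assert (Hbig : forall M t, t <= - M -> M < r t).
  { intros M t Ht. unfold r. pose proof (exp_lt_1 (-1 * t)). lra. }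
  (* The two bounds keep the coefficients below nonnegative: G - d^2 - eps D for x, and D (1 -
     eps^2) in the coupling for y + eps x. The denominator D + 1 covers D = 0. *)
  set (eps0 := Rmin 1 ((G - d ^ 2) / (D + 1))).
  assert (Heps0 : 0 < eps0).
  { apply Rmin_pos; [lra|]. apply Rdiv_lt_0_compat; lra. }
  assert (Hcoop : forall eps, 0 < eps <= eps0 ->
    (forall t, 0 < u (r t) + v (r t) /\ 0 < v (r t) - u (r t) + eps * (u (r t) + v (r t))) /\
    (forall s t, s <= t -> (u (r s) + v (r s)) / f (r s) <= (u (r t) + v (r t)) / f (r t))).
  { intros eps [Heps Hle].
    assert (Hle1 : eps <= 1) by (pose proof (Rmin_l 1 ((G - d ^ 2) / (D + 1))); unfold eps0 in *; lra).
    assert (HepsD : eps * D <= G - d ^ 2).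
    { pose proof (Rmin_r 1 ((G - d ^ 2) / (D + 1))) as H. fold eps0 in H.
      assert (H' : eps <= (G - d ^ 2) / (D + 1)) by lra.
      apply (Rmult_le_compat_r (D + 1)) in H'; [|lra].
      unfold Rdiv in H'. rewrite Rmult_assoc, Rinv_l in H' by lra. nra. }
    (* With E = [exp_decay] and relative errors eps/4, y >= -(eps/2) E while eps x >= (3/2) eps E,
       so y + eps x >= eps E > 0. *)
    destruct (is_sim_bound _ _ u exp_decay (eps / 4) Hu) as [Mu HMu]; [lra|].
    destruct (is_sim_bound _ _ v exp_decay (eps / 4) Hv) as [Mv HMv]; [lra|].
    assert (Hest : forall R, Mu < R -> Mv < R -> 1 <= R ->
      0 < u R + v R /\ 0 < v R - u R + eps * (u R + v R) /\
      u R + v R <= 10 / R /\ v R - u R + eps * (u R + v R) <= 10 / R).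
    { intros R HR1 HR2 HR3. destruct (exp_decay_bound R HR3) as [HE0 HE1].
      specialize (HMu R HR1). specialize (HMv R HR2). simpl in HMu, HMv.
      rewrite (Rabs_pos_eq (exp_decay R)) in HMu, HMv by lra.
      apply Rabs_le_between in HMu. apply Rabs_le_between in HMv.
      set (E := exp_decay R) in *.
      assert (eps / 4 * E <= E / 4) by nra.
      assert (3 / 2 * E <= u R + v R <= 5 / 2 * E) by lra.
      assert (eps * (3 / 2 * E) <= eps * (u R + v R)) by (apply Rmult_le_compat_l; lra).
      assert (eps * (u R + v R) <= 1 * (5 / 2 * E)) by (apply Rmult_le_compat; nra).
      assert (0 < eps * E) by (apply Rmult_lt_0_compat; lra).
      unfold Rdiv. repeat split; lra. }
    set (M := Rmax (Rmax Mu Mv) 1).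
    assert (HM : Mu <= M /\ Mv <= M /\ 1 <= M).
    { unfold M. pose proof (Rmax_l (Rmax Mu Mv) 1). pose proof (Rmax_r (Rmax Mu Mv) 1).
      pose proof (Rmax_l Mu Mv). pose proof (Rmax_r Mu Mv). lra. }
    assert (Hlim : forall e, 0 < e -> exists T, forall t, t <= T ->
       u (r t) + v (r t) <= e * f (r t) /\
       v (r t) - u (r t) + eps * (u (r t) + v (r t)) <= e * f (r t)).
    { intros e He. exists (- (M + Rinf + (10 / (e / 2) + 1))). intros t Ht.
      assert (0 <= 10 / (e / 2)) by (apply Rdiv_le_0_compat; lra).
      apply Hbig in Ht.
      destruct (Hest (r t)) as [_ [_ [H1 H2]]]; [lra|lra|lra|].
      destruct (Rdiv_small 10 (e / 2) (r t)) as [H3 _]; [lra|lra|lra|].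
      destruct (Hfinf (r t)) as [_ H4]; [lra|]. nra. }
    (* The coefficients come from substituting y = Y - eps x, with Y = y + eps x, into the system
       for (x, y). *)
    destruct (cooperative_positive (fun t => f (r t)) F1
      (fun t => u (r t) + v (r t)) (fun t => U1 t + V1 t)
      (fun t => v (r t) - u (r t) + eps * (u (r t) + v (r t)))
      (fun t => V1 t - U1 t + eps * (U1 t + V1 t))
      (fun t => d ^ 2 - r t ^ 2 * (1 - f (r t) ^ 2))
      (fun t => G - d ^ 2 - eps * D + 2 * r t ^ 2 * f (r t) ^ 2)
      (fun t => G - d ^ 2 + eps * D)
      (fun _ => D)
      (fun t => D * (1 - eps ^ 2) + 2 * eps * r t ^ 2 * f (r t) ^ 2)
      (- M)) as [H1 [H2 _]]; auto.
    - intros t. apply (is_derive_plus (fun t => u (r t)) (fun t => v (r t))); auto.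
    - intros t. assert (D1 := HU1 t). assert (D2 := HV1 t).
      auto_derive; [repeat split; eexists; eassumption|]. use_derive D1. use_derive D2.
      fold (r t). unfold G, D. field.
    - intros t. assert (D1 := HU t). assert (D2 := HV t).
      eapply is_derive_eq.
      { apply (is_derive_plus (fun t => v (r t) - u (r t)) (fun t => eps * (u (r t) + v (r t)))).
        - apply (is_derive_minus (fun t => v (r t)) (fun t => u (r t))); eassumption.
        - apply (is_derive_scal (fun t => u (r t) + v (r t))).
          apply (is_derive_plus (fun t => u (r t)) (fun t => v (r t))); eassumption. }
      unfold plus, minus, opp, scal; simpl. unfold plus, opp, mult; simpl. ring.
    - intros t. assert (D1 := HU1 t). assert (D2 := HV1 t).
      auto_derive; [repeat split; eexists; eassumption|]. use_derive D1. use_derive D2.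
      fold (r t). unfold G, D. field.
    - intros t. assert (0 <= r t ^ 2 * f (r t) ^ 2) by (apply Rmult_le_pos; apply pow2_ge_0).
      assert (0 <= eps * (r t ^ 2 * f (r t) ^ 2)) by (apply Rmult_le_pos; lra).
      repeat split; [lra|lra|nra|].
      assert (0 <= D * (1 - eps ^ 2)) by (apply Rmult_le_pos; nra). lra.
    - intros t Ht. apply Hbig in Ht. destruct (Hest (r t)) as [? [? _]]; [lra|lra|lra|]. auto.
    - intros e He. destruct (Hlim e He) as [T HT]. exists T. intros t Ht. apply HT, Ht.
    - intros e He. destruct (Hlim e He) as [T HT]. exists T. intros t Ht. apply HT, Ht. }
  destruct (Hcoop eps0) as [Hx Hmon]; [lra|].
  assert (Hy : forall t, 0 <= v (r t) - u (r t)).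
  { intros t. apply Rnot_lt_le. intros Hneg. destruct (Hx t) as [Hxt _].
    set (x := u (r t) + v (r t)) in *. set (y := v (r t) - u (r t)) in *.
    assert (Hq : 0 < - y / (2 * x)) by (apply Rdiv_lt_0_compat; lra).
    (* If y < 0 at this point, such an eps makes y + eps x <= y/2 < 0, against the positivity for
       every small eps. *)
    destruct (Hcoop (Rmin eps0 (- y / (2 * x)))) as [H _].
    { split; [apply Rmin_pos; lra|apply Rmin_l]. }
    destruct (H t) as [_ H']. fold x y in H'.
    pose proof (Rmin_r eps0 (- y / (2 * x))).
    assert (Rmin eps0 (- y / (2 * x)) * x <= - y / (2 * x) * x) by (apply Rmult_le_compat_r; lra).
    assert (- y / (2 * x) * x = - y / 2) by (field; lra). lra. }
  set (m := (u (r 0) + v (r 0)) / f (r 0)).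
  assert (Hm : 0 < m).
  { apply Rdiv_lt_0_compat; [apply Hx|apply Hfpos, Hr]. }
  set (T := 1 + Rabs (ln R0)).
  assert (HT1 : 1 <= T) by (unfold T; pose proof (Rabs_pos (ln R0)); lra).
  assert (HrT : forall t, T <= t -> r t <= R0).
  { intros t Ht. unfold r. rewrite <- (exp_ln R0) by exact HR0. apply Rlt_le, exp_increasing.
    unfold T in Ht. pose proof (Rle_abs (- ln R0)). rewrite Rabs_Ropp in *. lra. }
  (* The true size e^(-2t) is weakened to the integrable form expected by [perturbed_exp_growth]. *)
  assert (Hrt : forall t, T <= t -> r t ^ 2 <= 1 / t ^ 2).
  { intros t Ht. unfold r. replace (-1 * t) with (- t) by ring. rewrite exp_Ropp.
    unfold Rdiv. rewrite Rmult_1_l, pow_inv by (apply Rgt_not_eq, exp_pos).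
    apply Rinv_le_contravar; [apply pow_lt; lra|].
    apply pow_incr. pose proof (exp_lt_1 t). lra. }
  assert (Huv : forall t, Rabs (u (r t)) <= v (r t)).
  { intros t. destruct (Hx t) as [H1 _]. specialize (Hy t). apply Rabs_le. lra. }
  assert (Hh : forall t p q, T <= t -> Rabs p <= v (r t) -> Rabs q <= v (r t) ->
    Rabs (r t ^ 2 * ((2 * f (r t) ^ 2 - 1) * p + f (r t) ^ 2 * q)) <= 2 / t ^ 2 * v (r t)).
  { intros t p q Ht Hp Hq. destruct (Hf0 (r t)) as [_ Hf1]; [split; [apply Hr|auto]|].
    specialize (Hfpos (r t) (Hr t)).
    assert (0 <= f (r t) ^ 2 <= 1) by nra.
    assert (Hv0 : 0 <= v (r t)) by (pose proof (Rabs_pos p); lra).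
    replace (2 / t ^ 2 * v (r t)) with (1 / t ^ 2 * (2 * v (r t))) by (unfold Rdiv; ring).
    apply Rabs_mult_le.
    - rewrite Rabs_pos_eq by apply pow2_ge_0. auto.
    - eapply Rle_trans; [apply Rabs_triang|].
      assert (P1 := Rabs_mult_le (2 * f (r t) ^ 2 - 1) p 1 _ ltac:(apply Rabs_le; lra) Hp).
      assert (P2 := Rabs_mult_le (f (r t) ^ 2) q 1 _ ltac:(apply Rabs_le; lra) Hq). lra. }
  assert (Hg2 : d < gamma2) by (unfold G in HG; nra).
  (* The constant m c / 2 comes from v >= (u + v)/2 >= m f / 2 and f >= c r^d, where m is the ratio
     (u + v)/f at r = 1, that is at t = 0. *)
  destruct (perturbed_exp_growth (fun t => v (r t)) V1 (fun t => u (r t)) U1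
    (fun t => r t ^ 2 * ((2 * f (r t) ^ 2 - 1) * v (r t) + f (r t) ^ 2 * u (r t)))
    (fun t => r t ^ 2 * ((2 * f (r t) ^ 2 - 1) * u (r t) + f (r t) ^ 2 * v (r t)))
    d gamma1 gamma2 (m * c / 2) T) as [C [HC [HVlim HUlim]]]; auto.
  - lra.
  - apply Rdiv_lt_0_compat; [apply Rmult_lt_0_compat|]; lra.
  - intros t Ht. assert (Hvv : Rabs (v (r t)) <= v (r t)).
    { rewrite Rabs_pos_eq; [lra|]. eapply Rle_trans; [apply Rabs_pos|apply Huv]. }
    split; apply Hh; auto.
  - intros t Ht. destruct (Hf0 (r t)) as [Hfl _]; [split; [apply Hr|auto]|].
    replace (d * ln (r t)) with (- (d * t)) in Hfl by (unfold r; rewrite ln_exp; ring).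
    specialize (Hmon 0 t ltac:(lra)). fold m in Hmon.
    specialize (Hfpos (r t) (Hr t)).
    apply (Rmult_le_compat_r (f (r t))) in Hmon; [|lra].
    unfold Rdiv in Hmon. rewrite Rmult_assoc, Rinv_l, Rmult_1_r in Hmon by lra.
    specialize (Hy t).
    assert (m * (c * exp (- (d * t))) <= m * f (r t)) by (apply Rmult_le_compat_l; lra). lra.
  - assert (Hto0 : forall (P : R -> Prop) T', (forall t, T' <= t -> P (r t)) -> at_right 0 P).
    { intros P T' HP. apply at_right_0_iff. exists (r T'). split; [apply Hr|].
      intros s Hs. replace s with (r (- ln s)).
      - apply HP. unfold r in Hs.
        assert (ln s < -1 * T'); [|lra]. rewrite <- (ln_exp (-1 * T')).
        apply ln_increasing; apply Hs.
      - unfold r. replace (-1 * - ln s) with (ln s) by ring. apply exp_ln, Hs. }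
    assert (Hpow : forall t, Rpower (r t) (- gamma2) = exp (gamma2 * t)).
    { intros t. unfold r. rewrite Rpower_exp. f_equal. ring. }
    assert (Hinv : forall t, exp (gamma2 * t) * exp (- (gamma2 * t)) = 1).
    { intros t. rewrite <- exp_plus, Rplus_opp_r. apply exp_0. }
    exists C. split; [lra|split].
    + intros Hlt. specialize (HUlim Hlt). rewrite is_lim_infty_iff in HUlim.
      exists (fun s => u s / Rpower s (- gamma2)). split.
      * apply filterlim_locally. intros e.
        destruct (HUlim (e / 2)) as [T' HT']; [destruct e; simpl; lra|].
        apply (Hto0 _ T'). intros t Ht. specialize (HT' t Ht). rewrite Rminus_0_r in HT'.
        change (Rabs (u (r t) / Rpower (r t) (- gamma2) - 0) < e).
        rewrite Rminus_0_r, Hpow. unfold Rdiv. rewrite <- exp_Ropp, Rmult_comm.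
        destruct e; simpl in *; lra.
      * apply (Hto0 _ 0). intros t _. rewrite Hpow. field. apply Rgt_not_eq, exp_pos.
    + apply is_sim_intro; [apply at_right_proper_filter| |].
      * apply (Hto0 _ 0). intros t _. rewrite Hpow.
        apply Rgt_not_eq, Rmult_lt_0_compat; [exact HC|apply exp_pos].
      * intros e He. rewrite is_lim_infty_iff in HVlim.
        destruct (HVlim (C * e)) as [T' HT']; [nra|].
        apply (Hto0 _ T'). intros t Ht. specialize (HT' t Ht). rewrite Hpow.
        replace (v (r t) / (C * exp (gamma2 * t)) - 1)
          with (/ C * (exp (- (gamma2 * t)) * v (r t) - C)).
        -- rewrite Rabs_mult, Rabs_pos_eq by (apply Rlt_le, Rinv_0_lt_compat, HC).
           apply (Rmult_le_reg_l C); [exact HC|]. rewrite <- Rmult_assoc, Rinv_r by lra. lra.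
        -- rewrite exp_Ropp. field. split; [apply Rgt_not_eq, exp_pos|lra].
Qed.

(** Near 0, b is comparable to r^gamma2 and a is negligible against it, so a + b and b - a are both
    positive there, and cooperative comparison carries this outwards. The bound m f <= a + b is
    monotonicity of (a + b)/f from r = 1 on. *)
Lemma regular_solution_positive (d gamma1 gamma2 : R) (f a b : R -> R) :
  0 < d -> 0 <= gamma1 -> gamma1 <= gamma2 ->
  d ^ 2 < (gamma1 ^ 2 + gamma2 ^ 2) / 2 ->
  is_vortex_profile d f ->
  is_solution_S gamma1 gamma2 f a b ->
  is_bigO (at_right 0) a (fun r => Rpower r (gamma2 + 2 * d + 2)) ->
  is_sim (at_right 0) b (fun r => Rpower r gamma2) ->
  (forall r, 0 < r -> 0 < a r + b r /\ 0 < b r - a r) /\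
  exists m, 0 < m /\ forall r, 1 <= r -> m * f r <= a r + b r.
Proof.
  intros Hd Hg1 Hg12 HG Hf Hsol Ha Hb.
  destruct (vortex_profile_bounds d f Hd Hf) as [Hfpos [[c [R0 [Hc [HR0 Hf0]]]] _]].
  destruct (log_profile_equation 1 d f ltac:(lra) Hf) as [F1 [HF HF1]].
  destruct (log_system_equation 1 _ _ f a b ltac:(lra) Hsol) as [A1 [B1 [HA [HB [HA1 HB1]]]]].
  set (G := (gamma1 ^ 2 + gamma2 ^ 2) / 2) in *.
  set (D := (gamma2 ^ 2 - gamma1 ^ 2) / 2).
  assert (HD : 0 <= D) by (unfold D; nra).
  assert (Hg2 : d < gamma2) by (unfold G in HG; nra).
  set (r := fun t => exp (1 * t)) in *.
  assert (Hr : forall t, 0 < r t) by (intros; apply exp_pos).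
  assert (Hsmall : forall e, 0 < e -> exists T, forall t, t <= T -> r t < e).
  { intros e He. exists (ln e - 1). intros t Ht. unfold r.
    apply Rlt_le_trans with (exp (ln e)); [apply exp_increasing; lra|rewrite exp_ln; lra]. }
  destruct Ha as [C [HC Ha]]. apply at_right_0_iff in Ha. destruct Ha as [ea [Hea Ha]].
  assert (Hb' : at_right 0 (fun r => Rabs (b r - Rpower r gamma2) <= 1 / 4 * Rabs (Rpower r gamma2))).
  { apply is_sim_bound; [apply at_right_proper_filter|exact Hb|lra]. }
  apply at_right_0_iff in Hb'. destruct Hb' as [eb [Heb Hb']].
  destruct (Hsmall ea Hea) as [Ta HTa]. destruct (Hsmall eb Heb) as [Tb HTb].
  destruct (Hsmall R0 HR0) as [T0 HT0].
  assert (Hneg : forall C lam e, 0 < lam -> 0 < e ->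
             exists T, forall t, t <= T -> C * exp (lam * t) <= e).
  { intros C' lam e Hlam He.
    destruct (scaled_exp_decay_small C' lam e Hlam He) as [T HT].
    exists (- T). intros t Ht. specialize (HT (- t) ltac:(lra)).
    now replace (- (lam * - t)) with (lam * t) in HT by ring. }
  destruct (Hneg C (2 * d + 2) (1 / 4)) as [Tc HTc]; [lra|lra|].
  set (T := Rmin (Rmin Ta Tb) (Rmin T0 Tc)).
  assert (HT : T <= Ta /\ T <= Tb /\ T <= T0 /\ T <= Tc).
  { unfold T. pose proof (Rmin_l (Rmin Ta Tb) (Rmin T0 Tc)). pose proof (Rmin_r (Rmin Ta Tb) (Rmin T0 Tc)).
    pose proof (Rmin_l Ta Tb). pose proof (Rmin_r Ta Tb). pose proof (Rmin_l T0 Tc).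
    pose proof (Rmin_r T0 Tc). lra. }
  assert (Hest : forall t, t <= T ->
    Rabs (a (r t)) <= 1 / 4 * exp (gamma2 * t) /\
    3 / 4 * exp (gamma2 * t) <= b (r t) <= 5 / 4 * exp (gamma2 * t)).
  { intros t Ht.
    specialize (Ha (r t) (conj (Hr t) (HTa t ltac:(lra)))).
    specialize (Hb' (r t) (conj (Hr t) (HTb t ltac:(lra)))).
    simpl in Hb'. unfold r at 2 3 in Hb'. unfold r at 2 in Ha.
    rewrite Rpower_exp in Ha, Hb'.
    rewrite (Rabs_pos_eq (exp _)) in Ha by apply Rlt_le, exp_pos.
    rewrite (Rabs_pos_eq (exp _)) in Hb' by apply Rlt_le, exp_pos.
    rewrite Rmult_1_l in Ha, Hb'.
    apply Rabs_le_between in Hb'.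
    specialize (HTc t ltac:(lra)).
    replace ((gamma2 + 2 * d + 2) * t) with (gamma2 * t + (2 * d + 2) * t) in Ha by ring.
    rewrite exp_plus in Ha. pose proof (exp_pos (gamma2 * t)). split; [nra|lra]. }
  (* Both combinations are at most 2 r^gamma2 and f >= c r^d, so their ratios to f are O(r^(gamma2 -
     d)), which vanishes at 0. *)
  assert (Hlim : forall e, 0 < e -> exists T', forall t, t <= T' ->
     a (r t) + b (r t) <= e * f (r t) /\ b (r t) - a (r t) <= e * f (r t)).
  { intros e He.
    destruct (Hneg 2 (gamma2 - d) (e * c)) as [T' HT']; [lra|apply Rmult_lt_0_compat; lra|].
    exists (Rmin T T'). intros t Ht. pose proof (Rmin_l T T'). pose proof (Rmin_r T T').
    destruct (Hest t) as [H1 H2]; [lra|]. apply Rabs_le_between in H1.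
    destruct (Hf0 (r t)) as [H3 _].
    { split; [apply Hr|]. apply Rlt_le, HT0. lra. }
    specialize (HT' t ltac:(lra)).
    replace (d * ln (r t)) with (d * t) in H3 by (unfold r; rewrite ln_exp; ring).
    pose proof (exp_pos (gamma2 * t)).
    assert (2 * exp (gamma2 * t) <= e * f (r t)).
    { apply Rle_trans with (e * (c * exp (d * t))); [|apply Rmult_le_compat_l; lra].
      replace (gamma2 * t) with ((gamma2 - d) * t + d * t) by ring. rewrite exp_plus.
      pose proof (exp_pos (d * t)). nra. }
    lra. }
  destruct (cooperative_positive (fun t => f (r t)) F1
      (fun t => a (r t) + b (r t)) (fun t => A1 t + B1 t)
      (fun t => b (r t) - a (r t)) (fun t => B1 t - A1 t)
      (fun t => d ^ 2 - r t ^ 2 * (1 - f (r t) ^ 2))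
      (fun t => G - d ^ 2 + 2 * r t ^ 2 * f (r t) ^ 2)
      (fun t => G - d ^ 2) (fun _ => D) (fun _ => D) T) as [H1 [H2 _]]; auto.
  - intros t. apply (is_derive_plus (fun t => a (r t)) (fun t => b (r t))); auto.
  - intros t. assert (D1 := HA1 t). assert (D2 := HB1 t).
    auto_derive; [repeat split; eexists; eassumption|]. use_derive D1. use_derive D2.
    fold (r t). unfold G, D. field.
  - intros t. apply (is_derive_minus (fun t => b (r t)) (fun t => a (r t))); auto.
  - intros t. assert (D1 := HA1 t). assert (D2 := HB1 t).
    auto_derive; [repeat split; eexists; eassumption|]. use_derive D1. use_derive D2.
    fold (r t). unfold G, D. field.
  - intros t. assert (0 <= r t ^ 2 * f (r t) ^ 2) by (apply Rmult_le_pos; apply pow2_ge_0).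
    repeat split; lra.
  - intros t Ht. destruct (Hest t Ht) as [E1 E2]. apply Rabs_le_between in E1.
    pose proof (exp_pos (gamma2 * t)). lra.
  - intros e He. destruct (Hlim e He) as [T' HT']. exists T'. intros t Ht. apply HT', Ht.
  - intros e He. destruct (Hlim e He) as [T' HT']. exists T'. intros t Ht. apply HT', Ht.
  - assert (Er : forall s, 0 < s -> r (ln s) = s).
    { intros s Hs. unfold r. now rewrite Rmult_1_l, exp_ln. }
    split.
    + intros s Hs. rewrite <- (Er s Hs). apply H1.
    + exists ((a (r 0) + b (r 0)) / f (r 0)). split.
      * apply Rdiv_lt_0_compat; [apply H1|apply Hfpos, Hr].
      * intros s Hs. assert (Hs0 : 0 < s) by lra.
        specialize (H2 0 (ln s)). rewrite (Er s Hs0) in H2.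
        assert (Hln : 0 <= ln s).
        { rewrite <- ln_1. destruct Hs as [Hs|<-]; [|lra]. apply Rlt_le, ln_increasing; lra. }
        specialize (H2 Hln). specialize (Hfpos s Hs0).
        apply (Rmult_le_compat_r (f s)) in H2; [|lra].
        replace ((a s + b s) / f s * f s) with (a s + b s) in H2 by (field; lra). exact H2.
Qed.

(** The functions sqrt r (a + b) and sqrt r (b - a) satisfy the hypotheses of [coupled_exp_growth];
    the first stays away from 0 because a + b >= m f. *)
Lemma regular_solution_blows_up (d gamma1 gamma2 : R) (f a b : R -> R) :
  0 < d -> 0 <= gamma1 -> gamma1 <= gamma2 ->
  d ^ 2 < (gamma1 ^ 2 + gamma2 ^ 2) / 2 ->
  is_vortex_profile d f ->
  is_solution_S gamma1 gamma2 f a b ->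
  is_bigO (at_right 0) a (fun r => Rpower r (gamma2 + 2 * d + 2)) ->
  is_sim (at_right 0) b (fun r => Rpower r gamma2) ->
  blows_up_exponentially a b.
Proof.
  intros Hd Hg1 Hg12 HG Hf Hsol Ha Hb.
  destruct (regular_solution_positive d gamma1 gamma2 f a b) as [Hpos [m [Hm Hlow]]]; auto.
  destruct (vortex_profile_bounds d f Hd Hf) as [_ [_ [K [R0 [HK [HR0 Hfinf]]]]]].
  destruct Hsol as [Hda [Hdb Heq]].
  set (G := (gamma1 ^ 2 + gamma2 ^ 2) / 2) in *.
  set (D := (gamma2 ^ 2 - gamma1 ^ 2) / 2).
  assert (HD : 0 <= D) by (unfold D; nra).
  assert (Sa := sqrt_variable a Hda). assert (Sb := sqrt_variable b Hdb).
  set (A1 := fun r => sqrt r * Derive a r + a r / (2 * sqrt r)) in Sa.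
  set (B1 := fun r => sqrt r * Derive b r + b r / (2 * sqrt r)) in Sb. simpl in Sa, Sb.
  assert (Hsq : forall r, R0 <= r -> 1 <= sqrt r).
  { intros r Hr. rewrite <- sqrt_1. apply sqrt_le_1; lra. }
  (* In the common constant, 8 K bounds 3 |f^2 - 1| r^2 <= (15/2) K, using 1 + f <= 5/2, and G + 1
     bounds |G - 1/4|. The lower bound m/2 uses f >= 1/2 and sqrt r >= 1. *)
  destruct (coupled_exp_growth
    (fun r => sqrt r * a r + sqrt r * b r) (fun r => A1 r + B1 r)
    (fun r => sqrt r * b r - sqrt r * a r) (fun r => B1 r - A1 r)
    (fun r => (G - 1 / 4) / r ^ 2 + 3 * (f r ^ 2 - 1))
    (fun r => (G - 1 / 4) / r ^ 2 + (f r ^ 2 - 1))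
    (fun r => D / r ^ 2) (G + 1 + 8 * K + D) R0 (m / 2)) as [l [Hl [HX HY]]].
  - exact HR0.
  - lra.
  - intros r Hr. apply (is_derive_plus (fun r => sqrt r * a r) (fun r => sqrt r * b r));
      [apply Sa|apply Sb]; lra.
  - intros r Hr. destruct (Sa r ltac:(lra)) as [_ D1]. destruct (Sb r ltac:(lra)) as [_ D2].
    eapply is_derive_eq; [apply (is_derive_plus A1 B1); eassumption|].
    unfold plus; simpl. destruct (Heq r ltac:(lra)) as [E1 E2].
    replace (Derive (Derive a) r + Derive a r / r)
      with (gamma1 ^ 2 / r ^ 2 * a r + f r ^ 2 * b r + f r ^ 2 * a r - (1 - f r ^ 2) * a r) by lra.
    replace (Derive (Derive b) r + Derive b r / r)
      with (gamma2 ^ 2 / r ^ 2 * b r + f r ^ 2 * a r + f r ^ 2 * b r - (1 - f r ^ 2) * b r) by lra.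
    unfold G, D. field. lra.
  - intros r Hr. apply (is_derive_minus (fun r => sqrt r * b r) (fun r => sqrt r * a r));
      [apply Sb|apply Sa]; lra.
  - intros r Hr. destruct (Sa r ltac:(lra)) as [_ D1]. destruct (Sb r ltac:(lra)) as [_ D2].
    eapply is_derive_eq; [apply (is_derive_minus B1 A1); eassumption|].
    unfold minus, plus, opp; simpl. destruct (Heq r ltac:(lra)) as [E1 E2].
    replace (Derive (Derive a) r + Derive a r / r)
      with (gamma1 ^ 2 / r ^ 2 * a r + f r ^ 2 * b r + f r ^ 2 * a r - (1 - f r ^ 2) * a r) by lra.
    replace (Derive (Derive b) r + Derive b r / r)
      with (gamma2 ^ 2 / r ^ 2 * b r + f r ^ 2 * a r + f r ^ 2 * b r - (1 - f r ^ 2) * b r) by lra.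
    unfold G, D. field. lra.
  - intros r Hr. destruct (Hfinf r Hr) as [H1 H2].
    assert (Hr2 : 0 < r ^ 2) by (apply pow_lt; lra).
    assert (Hi : 0 < / r ^ 2) by (apply Rinv_0_lt_compat, Hr2).
    assert (HG0 : 0 <= G) by (unfold G; nra).
    assert (Hff : Rabs (f r ^ 2 - 1) <= 5 / 2 * (K / r ^ 2)).
    { replace (f r ^ 2 - 1) with (- (1 + f r) * (1 - f r)) by ring.
      apply Rabs_mult_le; [rewrite Rabs_Ropp, Rabs_pos_eq; lra|exact H1]. }
    assert (HGr : Rabs ((G - 1 / 4) / r ^ 2) <= (G + 1) * / r ^ 2).
    { apply Rabs_mult_le; [apply Rabs_le; lra|rewrite Rabs_pos_eq; lra]. }
    unfold Rdiv in *. set (i := / r ^ 2) in *.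
    assert (0 <= K * i) by (apply Rmult_le_pos; lra).
    assert (0 <= D * i) by (apply Rmult_le_pos; lra).
    assert (0 <= G * i) by (apply Rmult_le_pos; lra).
    repeat split.
    + eapply Rle_trans; [apply Rabs_triang|]. rewrite (Rabs_mult 3), (Rabs_pos_eq 3) by lra. lra.
    + eapply Rle_trans; [apply Rabs_triang|]. lra.
    + lra.
    + lra.
  - intros r Hr. destruct (Hpos r ltac:(lra)) as [P1 P2]. specialize (Hlow r ltac:(lra)).
    destruct (Hfinf r Hr) as [_ H2]. specialize (Hsq r Hr). split; [|nra].
    assert (m * (1 / 2) <= m * f r) by (apply Rmult_le_compat_l; lra). nra.
  - rewrite is_lim_infty_iff in HX, HY.
    exists (l / 2). split; [lra|].
    assert (Hgen : forall h, (forall e, 0 < e -> exists T, forall r, T <= r ->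
        Rabs (exp (- (sqrt 2 * r)) * (sqrt r * h r) - l / 2) <= e) ->
      is_sim (Rbar_locally p_infty) h (fun r => l / 2 * exp_growth r)).
    { intros h Hh.
      assert (Hpos' : forall r, R0 < r -> 0 < exp_growth r).
      { intros r Hr. unfold exp_growth. specialize (Hsq r ltac:(lra)).
        apply Rdiv_lt_0_compat; [apply exp_pos|lra]. }
      apply is_sim_intro; [apply Rbar_locally_filter| |].
      - exists R0. intros r Hr. specialize (Hpos' r Hr).
        apply Rgt_not_eq, Rmult_lt_0_compat; lra.
      - intros e He. destruct (Hh (l / 2 * e)) as [T HT]; [apply Rmult_lt_0_compat; lra|].
        exists (Rmax T R0). intros r Hr. pose proof (Rmax_l T R0). pose proof (Rmax_r T R0).
        specialize (HT r ltac:(lra)). specialize (Hsq r ltac:(lra)).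
        replace (h r / (l / 2 * exp_growth r) - 1)
          with (/ (l / 2) * (exp (- (sqrt 2 * r)) * (sqrt r * h r) - l / 2)).
        + rewrite Rabs_mult, Rabs_pos_eq by (apply Rlt_le, Rinv_0_lt_compat; lra).
          apply (Rmult_le_reg_l (l / 2)); [lra|]. rewrite <- Rmult_assoc, Rinv_r by lra. lra.
        + unfold exp_growth. rewrite exp_Ropp. field. repeat split; try lra.
          apply Rgt_not_eq, exp_pos. }
    (* As a and b are half the difference and half the sum of the two combinations, and b - a is of
       lower order, both have the coefficient l/2. *)
    split; apply Hgen; intros e He; destruct (HX e He) as [T1 HT1]; destruct (HY e He) as [T2 HT2];
      exists (Rmax T1 T2); intros r Hr; pose proof (Rmax_l T1 T2); pose proof (Rmax_r T1 T2);
      specialize (HT1 r ltac:(lra)); specialize (HT2 r ltac:(lra));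
      apply Rabs_le_between in HT1; apply Rabs_le_between in HT2; apply Rabs_le; lra.
Qed.

(* In the second part, when gamma1 = gamma2 the system is symmetric in its two
   unknowns, so (v, u) has the behavior defining (u, v) and u = v; then u cannot
   be o(r^(-gamma2)) while v ~ C r^(-gamma2) with C <> 0.  The little-o claim is
   therefore made for gamma1 < gamma2, and everything else for
   gamma1 <= gamma2. *)
Theorem theorem6 (d gamma1 gamma2 : R) (f : R -> R)
  (hd : 0 < d) (hgamma1 : 0 <= gamma1) (hgamma12 : gamma1 <= gamma2)
  (hgamma : d ^ 2 < (gamma1 ^ 2 + gamma2 ^ 2) / 2)
  (hf : is_vortex_profile d f) :
  (forall a b : R -> R,
     is_solution_S gamma1 gamma2 f a b ->
     is_bigO (at_right 0) a (fun r => Rpower r (gamma2 + 2 * d + 2)) ->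
     is_sim (at_right 0) b (fun r => Rpower r gamma2) ->
     blows_up_exponentially a b) /\
  (forall u v : R -> R,
     is_solution_S gamma1 gamma2 f u v ->
     is_sim (Rbar_locally p_infty) u exp_decay ->
     is_sim (Rbar_locally p_infty) v exp_decay ->
     exists C : R, C <> 0 /\
       (gamma1 < gamma2 ->
        is_littleo (at_right 0) u (fun r => Rpower r (- gamma2))) /\
       is_sim (at_right 0) v (fun r => C * Rpower r (- gamma2))).
Proof.
  split.
  - intros a b. now apply (regular_solution_blows_up d).
  - intros u v. now apply (decaying_solution_at_0 d).
Qed.
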